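(* Let $n\ge 2$. Let $g:[0,\infty)\to\mathbb{R}$ be of class $C^{2,\gamma}([0,\infty))$ for some exponent $0<\gamma<1$ and assume: (i) (linear growth) there are constants $c_1, C_1>0$ and $c_2, C_2\ge 0$ such that $c_1t-c_2\le g(t)\le C_1t+C_2$ for all $t\ge 0$; (ii) $g''(t)>0$ for all $t\ge 0$; (iii) $g'(0)=0$; (iv) $\int_0^\infty t\,g''(t)\,dt<\infty$; (v) (normalization) $\lim_{t\to\infty}g'(t)=1$. Let $0<r<R<\infty$, let $D=B_R(0)\setminus\overline{B_r(0)}\subset\mathbb{R}^n$, and let $u\in C^2(D)\cap C^1(\overline{D})$ be a real-valued solution of $$\operatorname{div}\left[\frac{g'(|\nabla u|)}{|\nabla u|}\nabla u\right]=0\quad\text{on } D.$$ Put $\alpha:=r^{n-1}$ and suppose that for some $a\in\mathbb{R}$ $$u\le k^{-}_{\alpha,a}\quad\text{on }\partial B_R(0).$$ Then $$u\le k^{-}_{\alpha,a}\quad\text{throughout }\overline{D}.$$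
   Context: $B_\rho(0)$ denotes the open ball of radius $\rho$ centered at $0$ in $\mathbb{R}^n$. Since $g''(t)>0$ for all $t\ge 0$, $g'(0)=0$ and $\lim_{t\to\infty}g'(t)=1$, the function $g'$ is strictly increasing and maps $[0,\infty)$ bijectively onto $[0,1)$; $(g')^{-1}:[0,1)\to[0,\infty)$ denotes its inverse. For $\alpha>0$ and $a\in\mathbb{R}$, the function $k^{-}_{\alpha,a}$ is defined for $|x|>\alpha^{1/(n-1)}$ by $$k^{-}_{\alpha,a}(x):=-\int_{\alpha^{1/(n-1)}}^{|x|}(g')^{-1}\left(\frac{\alpha}{t^{n-1}}\right)dt+a,$$ where the (improper) integral converges because $g\in C^2([0,\infty))$ satisfies $g''(t)>0$ for all $t\ge 0$, $g'(0)=0$, $\lim_{t\to\infty}g'(t)=1$ and $\int_0^\infty t\,g''(t)\,dt<\infty$, and it is extended continuously by the value $a$ to $|x|=\alpha^{1/(n-1)}$. The equation is understood pointwise (classically) for $C^2$ functions, where the vector $\frac{g'(|p|)}{|p|}p$ is understood as $0$ for $p=0$. *)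

(* Defs.v *)
(* Points of R^n are row vectors, of type 'rV[R]_n. *)
From HB Require Import structures.
From mathcomp Require Export all_boot all_order all_algebra.
From mathcomp Require Export all_classical all_reals all_analysis.
Export Order.TTheory GRing.Theory Num.Theory.
Export numFieldNormedType.Exports.

Set Implicit Arguments.
Unset Strict Implicit.
Unset Printing Implicit Defensive.

Global Open Scope classical_set_scope.
Global Open Scope ring_scope.

Section OneVariable.
Context {R : realType}.

(* Derivative relative to A: only increments h with t + h in A are considered,
   so that with A = [0, +oo[ the derivative at 0 is the right one and the values
   of f on the negative reals are irrelevant. *)
Definition derivable_in (A : set R) (f : R -> R) (t : R) : Prop :=
  cvg ((fun h => h^-1 * (f (t + h) - f t)) @ within [set h | A (t + h)] 0^').

Definition derive_in (A : set R) (f : R -> R) (t : R) : R :=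
  lim ((fun h => h^-1 * (f (t + h) - f t)) @ within [set h | A (t + h)] 0^').

Definition nneg : set R := `[0, +oo[%classic.

Definition d1 (g : R -> R) : R -> R := derive_in nneg g.
Definition d2 (g : R -> R) : R -> R := derive_in nneg (d1 g).

(* The Hoelder condition on the second derivative is imposed on every [0, M]
   with a constant depending on M; it implies continuity of d2 g. *)
Definition C2_hoelder (gamma : R) (g : R -> R) : Prop :=
  [/\ forall t, 0 <= t -> derivable_in nneg g t,
      forall t, 0 <= t -> derivable_in nneg (d1 g) t &
      forall M, exists C, forall s t, 0 <= s <= M -> 0 <= t <= M ->
        `|d2 g s - d2 g t| <= C * `|s - t| `^ gamma].

(* Inverse of g' : [0, +oo[ -> [0, 1[. *)
Definition d1inv (g : R -> R) : R -> R := 'pinv_(fun=> 0) nneg (d1 g).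

End OneVariable.

Section SeveralVariables.
Context {R : realType} {n : nat}.
Implicit Types (x y : 'rV[R]_n) (u : 'rV[R]_n -> R) (A : set 'rV[R]_n).

(* The library norm on 'rV[R]_n is the maximum norm. *)
Definition enorm x : R := Num.sqrt (\sum_(i < n) x 0 i ^+ 2).

Definition eball (rho : R) : set 'rV[R]_n := [set x | enorm x < rho].

Definition boundary A : set 'rV[R]_n := closure A `\` interior A.

Definition annulus (r rho : R) : set 'rV[R]_n :=
  eball rho `\` closure (eball r).

Definition partial (i : 'I_n) u : 'rV[R]_n -> R := 'D_(delta_mx 0 i) u.

Definition grad u x : 'rV[R]_n := \row_i partial i u x.

Definition divergence (F : 'rV[R]_n -> 'rV[R]_n) x : R :=
  \sum_(i < n) partial i (fun y => F y 0 i) x.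

(* A is meant to be open in the next three definitions. *)
Definition C1_on A u : Prop :=
  (forall x, A x -> {for x, continuous u}) /\
  forall i x, A x ->
    derivable u x (delta_mx 0 i) /\ {for x, continuous (partial i u)}.

Definition C2_on A u : Prop := C1_on A u /\ forall i, C1_on A (partial i u).

(* u and its first partial derivatives on A extend continuously to the closure;
   the extension of u is u itself. *)
Definition C1_on_closure A u : Prop :=
  [/\ C1_on A u, {within closure A, continuous u} &
      forall i, exists v : 'rV[R]_n -> R,
        {within closure A, continuous v} /\ {in A, v =1 partial i u}].

(* Since 0^-1 = 0, the field is 0 wherever the gradient vanishes. *)
Definition flux (g : R -> R) u x : 'rV[R]_n :=
  (d1 g (enorm (grad u x)) / enorm (grad u x)) *: grad u x.

(* The integrand is nonnegative, so the improper integral is a Lebesgue one; for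
   |x| = alpha^(1/(n-1)) the domain of integration is empty and the value is a. *)
Definition kminus (g : R -> R) (alpha a : R) x : R :=
  - (\int[lebesgue_measure]_(t in `]alpha `^ (n.-1%:R^-1), enorm x[)
       d1inv g (alpha / t ^+ n.-1))%R + a.

End SeveralVariables.

(* Main.v *)
Require Import Defs.
From mathcomp Require Import lra ring measurable_realfun.

Set Implicit Arguments.
Unset Strict Implicit.
Unset Printing Implicit Defensive.

(** The barrier k = k^-_{alpha,a} is radial and decreasing, with slope
F(alpha / t^(n-1)) in absolute value, where F is the inverse of g'. This slope
is infinite at the inner radius r, because alpha / r^(n-1) = 1. As the gradient
of u is bounded, u - k increases when one leaves the inner sphere, so u - k
cannot be maximal there, and at an interior maximum the ellipticity of the
equation should give a contradiction.

To have a strict inequality at an interior maximum, without the strong maximum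
principle, the barrier is perturbed. For 0 < eps < 1 put
psi_eps(t) = (1 - eps) (r / t)^(n-1) + eps and let phi_eps be the radial function
with phi_eps' = - F(psi_eps) and phi_eps(rho) = k(rho). Its flux is
- psi_eps(|x|) x / |x|, whose divergence is - (n-1) eps / |x| < 0
([is_derive_psi]). If u - phi_eps is maximal at an interior point x, then
grad u(x) = - sigma nu with sigma = F(psi_eps(|x|)) and nu = x / |x|, and the
second derivatives of u at x in the direction nu and in the directions
orthogonal to nu are at most those of phi_eps ([radial_touching]). Written as
(g'(sigma) / sigma) (tr H - H[nu]) + g''(sigma) H[nu], where H is the Hessian of
u ([divergence_flux]), the divergence of the flux of u is therefore negative: a
contradiction ([no_interior_touching]). The quantity tr H - H[nu] is the sum of
the values of H at the projections of the canonical basis on the orthogonal of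
nu ([hess_frame]), so that no orthonormal frame has to be built.

Suppose now that u(x1) > k(x1) with r < |x1| < rho. Since F(psi_eps) is at least
F(psi_0), which is infinite at r, some radius r1 < |x1| is such that
F(psi_eps(r1)) exceeds the bound of the gradient of u. On the shell
r1 <= |x| <= rho the maximum of u - phi_eps is attained neither on the inner
sphere nor at an interior point; on the outer sphere u - phi_eps is nonpositive.
Hence u <= phi_eps on this shell. When eps is small, F(psi_eps) exceeds F(psi_0)
as little as one wants for t >= |x1| ([slope_perturbation]), so phi_eps(x1) is
close to k(x1), and this is a contradiction.

On the inner sphere it is enough that k <= a elsewhere and that u is continuous.

The derivative of k is computed by the fundamental theorem of calculus, which
requires F((r / t)^(n-1)) to be integrable near t = r ([slope_integrable]). The
Legendre transform y F(y) - g(F(y)) is a primitive of F, and the hypothesis on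
t g''(t) says exactly that it is bounded ([legendre_bounded]). *)

(** * One-sided derivatives and the inverse of the derivative of g *)

Section OneSided.
Context {R : realType}.
Implicit Types (f : R -> R) (t : R).

(** Away from 0, differentiability relative to [0, +oo[ is the ordinary one. *)
Lemma derivable_in_nneg_is_derive f t : 0 < t -> derivable_in nneg f t ->
  is_derive t 1 f (derive_in nneg f t).
Proof.
move=> t0 fd.
have E : within [set h | nneg (t + h)] 0^' = (0 : R)^' :> set (set R).
  apply/seteqP; split => A; last exact: cvg_within.
  rewrite /within /= => AP.
  have : \forall h \near (0 : R)^', nneg (t + h).
    apply: cvg_within; near=> h; rewrite /nneg /= in_itv /= andbT.
    rewrite -lerBlDl sub0r ltW//; near: h; apply: lt_nbhsr.
    by rewrite oppr_lt0.
  move=> N; near=> h; have := near AP h; apply => //.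
  by near: h; exact: N.
have F : (fun h : R => h^-1 *: ((f \o shift t) (h *: (1 : R)) - f t)) =
   (fun h => h^-1 * (f (t + h) - f t)).
  by apply/funext => h /=; rewrite [_%:A]mulr1 (addrC h).
split; first by rewrite /derivable F; move: fd; rewrite /derivable_in E.
by rewrite /derive_in /derive F E.
Unshelve. all: by end_near. Qed.

Lemma derivable_in_nneg_right f : derivable_in nneg f 0 ->
  f x @[x --> 0^'+] --> f 0.
Proof.
rewrite /derivable_in; set q := (fun h => _) => /cvg_ex[l ql].
have W : (0 : R)^'+ --> within [set h | nneg (0 + h)] (0 : R)^'.
  move=> A /= AP.
  have : \forall x \near (0 : R), x != 0 -> nneg (0 + x) -> A x := AP.
  change ((\forall x \near (0 : R), x != 0 -> nneg (0 + x) -> A x) ->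
    \forall x \near (0 : R), 0 < x -> A x).
  apply: filterS => x xA x0; apply: xA; first by rewrite gt_eqF.
  by rewrite add0r /nneg /= in_itv /= ltW.
have H : q x @[x --> (0:R)^'+] --> l by exact: cvg_trans (cvg_app q W) ql.
have : (fun x => x * q x + f 0) x @[x --> (0:R)^'+] --> 0 * l + f 0.
  apply: cvgD; last exact: cvg_cst.
  apply: cvgM => //; by apply: cvg_at_right_filter; exact: cvg_id.
rewrite mul0r add0r; apply: cvg_trans; apply: near_eq_cvg; near=> x.
rewrite /q add0r mulrA mulfV ?mul1r ?subrK// gt_eqF//.
Unshelve. all: by end_near. Qed.

Lemma derivable_in_nneg_continuous f :
  (forall t, 0 <= t -> derivable_in nneg f t) ->
  {within `[0, +oo[, continuous f}.
Proof.
move=> fd; apply/continuous_within_itvcyP; split.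
  move=> x; rewrite in_itv/= andbT => x0.
  have [d _] := derivable_in_nneg_is_derive x0 (fd _ (ltW x0)).
  exact/differentiable_continuous/derivable1_diffP.
exact/derivable_in_nneg_right/fd.
Qed.

End OneSided.

Section Profile.
Context {R : realType} (g : R -> R) (gamma : R).
Implicit Types (s t x y M eta : R).
Hypothesis gamma0 : 0 < gamma.
Hypothesis gC2 : C2_hoelder gamma g.
Hypothesis g2_gt0 : forall t : R, 0 <= t -> 0 < d2 g t.
Hypothesis g1_0 : d1 g 0 = 0.
Hypothesis g1_lim : d1 g t @[t --> +oo] --> (1 : R).

Lemma is_derive_g t : 0 < t -> is_derive t 1 g (d1 g t).
Proof.
by case: gC2 => H _ _ t0; apply: derivable_in_nneg_is_derive => //; exact/H/ltW.
Qed.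

Lemma is_derive_d1 t : 0 < t -> is_derive t 1 (d1 g) (d2 g t).
Proof.
by case: gC2 => _ H _ t0; apply: derivable_in_nneg_is_derive => //; exact/H/ltW.
Qed.

Lemma g_continuous : {within `[0, +oo[, continuous g}.
Proof. by case: gC2 => H _ _; exact: derivable_in_nneg_continuous. Qed.

Lemma d1_continuous : {within `[0, +oo[, continuous (d1 g)}.
Proof. by case: gC2 => _ H _; exact: derivable_in_nneg_continuous. Qed.

Lemma d1_continuous_segment (a b : R) : 0 <= a -> {within `[a, b], continuous (d1 g)}.
Proof.
move=> a0; apply: continuous_subspaceW d1_continuous => x /=.
by rewrite !in_itv/= andbT => /andP[/(le_trans a0)].
Qed.

Lemma d1_MVT s t : 0 <= s -> s < t ->
  exists2 x, s < x < t & d1 g t - d1 g s = d2 g x * (t - s).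
Proof.
move=> s0 st; have D x : x \in `]s, t[ -> is_derive x 1 (d1 g) (d2 g x).
  by rewrite in_itv/= => /andP[sx _]; exact/is_derive_d1/(le_lt_trans s0).
have [x xst E] := MVT st D (d1_continuous_segment s0).
by exists x => //; rewrite in_itv in xst.
Qed.

Lemma d1_lt s t : 0 <= s -> s < t -> d1 g s < d1 g t.
Proof.
move=> s0 st; have [x /andP[sx _] E] := d1_MVT s0 st.
by rewrite -subr_gt0 E mulr_gt0 ?subr_gt0// g2_gt0// (le_trans s0)// ltW.
Qed.

Lemma d1_le s t : 0 <= s -> s <= t -> d1 g s <= d1 g t.
Proof.
by move=> s0; rewrite le_eqVlt => /orP[/eqP->//|st]; exact/ltW/d1_lt.
Qed.

Lemma d1_ge0 t : 0 <= t -> 0 <= d1 g t.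
Proof. by move=> t0; rewrite -g1_0 d1_le. Qed.

Lemma d1_lt1 t : 0 <= t -> d1 g t < 1.
Proof.
move=> t0; apply: (@lt_le_trans _ _ (d1 g (t + 1))); first by rewrite d1_lt// ltrDl.
have t1 : 0 <= t + 1 by rewrite addr_ge0.
move: (t + 1) t1 => M M0.
have -> : 1 = lim (d1 g x @[x --> +oo]) by rewrite (cvg_lim _ g1_lim).
apply: limr_ge; first exact: (cvgP _ g1_lim).
near=> x; rewrite d1_le//.
Unshelve. all: by end_near. Qed.

Lemma d1_surj y : 0 <= y < 1 -> exists2 t, 0 <= t & d1 g t = y.
Proof.
move=> /andP[y0 y1].
have /cvgrPdist_lt/(_ (1 - y)) := g1_lim.
rewrite subr_gt0 => /(_ y1) N.
have [M [M0 HM]] : exists M, 0 <= M /\ y < d1 g M.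
  near (pinfty_nbhs R) => M; exists M; split; first by near: M; exact: nbhs_pinfty_ge.
  have : `|1 - d1 g M| < 1 - y by near: M.
  by rewrite ltr_norml => /andP[_]; lra.
have yM : Num.min (d1 g 0) (d1 g M) <= y <= Num.max (d1 g 0) (d1 g M).
  by rewrite g1_0 minEle maxEle (d1_ge0 M0)/= y0 ltW.
have [t tM E] := IVT M0 (d1_continuous_segment (lexx 0)) yM.
by exists t => //; rewrite (itvP tM).
Unshelve. all: by end_near. Qed.

Lemma d1_inj : {in nneg &, injective (d1 g)}.
Proof.
move=> s t; rewrite !inE /nneg/= !in_itv/= !andbT => s0 t0 E.
apply/eqP; case: ltgtP => // H.
  by have := d1_lt s0 H; rewrite E ltxx.
by have := d1_lt t0 H; rewrite E ltxx.
Qed.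

Lemma d1K t : 0 <= t -> d1inv g (d1 g t) = t.
Proof.
by move=> t0; apply: (pinvKV _ d1_inj); rewrite inE /nneg/= in_itv/= andbT.
Qed.

Lemma d1inv_ge0 y : 0 <= y < 1 -> 0 <= d1inv g y.
Proof. by move=> /d1_surj[t t0 <-]; rewrite d1K. Qed.

Lemma d1invK y : 0 <= y < 1 -> d1 g (d1inv g y) = y.
Proof. by move=> /d1_surj[t t0 <-]; rewrite d1K. Qed.

Lemma d1inv_gt0 y : 0 < y < 1 -> 0 < d1inv g y.
Proof.
move=> /andP[y0 y1]; have yI : 0 <= y < 1 by rewrite ltW.
rewrite lt_neqAle d1inv_ge0// andbT; apply/eqP => E.
by have := d1invK yI; rewrite -E g1_0 => E'; move: y0; rewrite -E' ltxx.
Qed.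

(** Galois-type rule to move the inverse of g' across an inequality. *)
Lemma d1inv_le_d1 y t : 0 <= y < 1 -> 0 <= t -> (d1inv g y <= t) = (y <= d1 g t).
Proof.
move=> /d1_surj[s s0 <-] t0; rewrite d1K//; apply/idP/idP; first exact: d1_le.
by apply: contraTT; rewrite -!ltNge; exact: d1_lt.
Qed.

Lemma is_derive_d1inv y : 0 < y < 1 ->
  is_derive y 1 (d1inv g) (d2 g (d1inv g y))^-1.
Proof.
move=> yI; have /andP[y0 y1] := yI; have yI' : 0 <= y < 1 by rewrite ltW.
have t0 := d1inv_gt0 yI.
rewrite -[X in is_derive X](d1invK yI').
apply: is_derive_inverse; last by rewrite gt_eqF// g2_gt0// ltW.
- near=> t; apply: d1K; rewrite ltW//; near: t; exact: lt_nbhsr.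
- near=> t; apply/differentiable_continuous/derivable1_diffP.
  have /is_derive_d1[]// : 0 < t.
  by near: t; exact: lt_nbhsr.
- exact: is_derive_d1.
Unshelve. all: by end_near. Qed.

Lemma d2_continuous M : {within `[0, M], continuous (d2 g)}.
Proof.
case: gC2 => _ _ /(_ M)[C HC]; apply/subspace_continuousP => x xM.
apply/cvgrPdist_le => e e0; have C0 : 0 < `|C| + 1 by rewrite ltr_wpDl.
pose del := (e / (`|C| + 1)) `^ gamma^-1.
have del0 : 0 < del by rewrite powR_gt0// divr_gt0.
have N : \forall y \near (x : R), `|(x : R) - y| <= del.
  by have /cvgrPdist_le := @cvg_id _ (nbhs (x : R)); exact.
rewrite near_withinE; apply: filterS N => y Ny yM.
rewrite /= in_itv/= in xM; rewrite /= in_itv/= in yM.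
apply: le_trans (HC _ _ xM yM) _.
apply: (@le_trans _ _ ((`|C| + 1) * del `^ gamma)).
  apply: (@le_trans _ _ ((`|C| + 1) * `|x - y| `^ gamma)).
    by apply: ler_wpM2r; rewrite ?powR_ge0// (le_trans (ler_norm _))// lerDl.
  apply: ler_wpM2l; first exact: ltW.
  apply: ge0_ler_powR; rewrite ?nnegrE ?(ltW gamma0) ?(ltW del0)//.
rewrite -powRrM mulVf ?gt_eqF// powRr1 ?divr_ge0 ?(ltW e0) ?(ltW C0)//.
by rewrite mulrCA mulfV ?mulr1// gt_eqF.
Qed.

(** A uniform strict monotonicity of g' on compact intervals, from the positive
minimum of g''. *)
Lemma d1_increment M eta : 0 < eta -> 0 <= M -> exists2 m, 0 < m &
  forall t, 0 <= t <= M -> d1 g t + m <= d1 g (t + eta).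
Proof.
move=> eta0 M0; have M0' : 0 <= M + eta by rewrite addr_ge0// ltW.
have [c cM H] := EVT_min M0' (@d2_continuous (M + eta)).
exists (d2 g c * eta); first by rewrite mulr_gt0// g2_gt0// (itvP cM).
move=> t /andP[t0 tM].
have tt : t < t + eta by rewrite ltrDl.
have [x /andP[tx xt] E] := d1_MVT t0 tt.
rewrite -lerBrDl E addrC addKr ler_wpM2r ?(ltW eta0)// H// in_itv/=.
by rewrite (le_trans t0) ?(ltW tx)//= (le_trans (ltW xt))// lerD2r.
Qed.

End Profile.

(** * Functions of one real variable *)

Section BoundedPrimitive.
Context {R : realType}.
Notation mu := (@lebesgue_measure R).

Lemma is_derive_continuous (f : R -> R) (x l : R) :
  is_derive x 1 f l -> {for x, continuous f}.
Proof. by case=> d _; exact/differentiable_continuous/derivable1_diffP. Qed.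

(** The product rule with scalar multiplication spelled as multiplication. *)
Lemma is_derive_mul (f h : R -> R) (x a b : R) :
  is_derive x 1 f a -> is_derive x 1 h b ->
  is_derive x 1 (fun t => f t * h t) (f x * b + a * h x).
Proof.
by move=> Df Dh; apply: is_derive_eq (is_deriveM Df Dh) _; rewrite [a * _]mulrC.
Qed.

Lemma continuous_within_segment (f : R -> R) (a b : R) :
  (forall x, a <= x <= b -> {for x, continuous f}) ->
  {within `[a, b], continuous f}.
Proof.
move=> cf; apply/subspace_continuousP => x /=; rewrite in_itv/= => xab.
have H : f y @[y --> (x : R)] --> f x := cf x xab.
by apply: cvg_within_filter; exact: H.
Qed.

(** A nonnegative continuous function on an open interval is integrable as soon as
it has a bounded primitive: its integrals over compact subintervals are bounded,
and monotone convergence applies. *)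
Lemma integrable_bounded_primitive (a b C : R) (B dB : R -> R) : a < b ->
  (forall x, a < x < b -> is_derive x 1 B (dB x)) ->
  (forall x, a < x < b -> {for x, continuous dB}) ->
  (forall x, a < x < b -> 0 <= dB x) ->
  (forall x, a < x < b -> `|B x| <= C) ->
  mu.-integrable `]a, b[ (EFin \o dB).
Proof.
move=> ab dBB cdB dB0 BC.
have mdB : measurable_fun `]a, b[ dB.
  apply: open_continuous_measurable_fun; first exact: interval_open.
  by move=> x; rewrite inE/= in_itv/=; exact: cdB.
(* The factor 1/3 keeps the shrunken intervals nondegenerate already for n = 0. *)
pose e n : R := (b - a) / 3 * harmonic n.
have e_gt0 n : 0 < e n by rewrite mulr_gt0 ?harmonic_gt0// divr_gt0// subr_gt0.
have e_le n : e n <= (b - a) / 3.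
  rewrite ler_piMr// ?divr_ge0 ?subr_ge0 ?(ltW ab)//.
  by rewrite /harmonic invf_le1// ler1n.
have e_dec m n : (m <= n)%N -> e n <= e m.
  move=> mn; rewrite ler_wpM2l// ?divr_ge0 ?subr_ge0 ?(ltW ab)//.
  by rewrite /harmonic lef_pV2 ?posrE// ler_nat.
pose F n : set R := `[a + e n, b - e n]%classic.
have Fsub n x : F n x -> a < x < b.
  rewrite /F/= in_itv/=; have := e_gt0 n; lra.
have FE : \bigcup_n F n = `]a, b[%classic.
  apply/seteqP; split=> x; first by move=> [n _] /Fsub; rewrite /= in_itv.
  rewrite /= in_itv/= => /andP[ax xb].
  have e0 : e n @[n --> \oo] --> (0 : R).
    by rewrite -[X in _ --> X](mulr0 ((b - a) / 3)); apply: cvgMr; exact: cvg_harmonic.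
  pose d := Num.min (x - a) (b - x).
  have d0 : 0 < d by rewrite lt_min !subr_gt0 ax xb.
  have [N _ /(_ N (leqnn _)) HN] := (cvgrPdist_lt _ _).1 e0 d d0.
  exists N => //; rewrite /F/= in_itv/=; move: HN.
  by rewrite sub0r normrN gtr0_norm// lt_min => /andP[]; lra.
have nnF : nondecreasing_seq F.
  move=> m n mn; rewrite subsetEset => x; rewrite /F/= !in_itv/=.
  by have := e_dec _ _ mn; lra.
have dB0' i x : F i x -> (0 <= (EFin \o dB) x)%E.
  by move=> /Fsub /dB0; rewrite lee_fin.
have IF n : (\int[mu]_(x in F n) (EFin \o dB) x <= (C *+ 2)%:E)%E.
  have abn : a + e n < b - e n by have := e_le n; lra.
  rewrite (@continuous_FTC2 _ dB B _ _ abn).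
  - rewrite lee_fin (le_trans (ler_norm _))// (le_trans (ler_normB _ _))//.
    by rewrite mulr2n lerD//; apply/BC/(@Fsub n); rewrite /F/= in_itv/= lexx ltW.
  - by apply: continuous_within_segment => x xF; apply/cdB/(@Fsub n); rewrite /F/= in_itv.
  - split.
    + move=> x; rewrite in_itv/= => /andP[x1 x2].
      have [] // : is_derive x 1 B (dB x).
      by apply/dBB/(@Fsub n); rewrite /F/= in_itv/= !ltW.
    + apply: cvg_at_right_filter; apply: is_derive_continuous.
      by apply/dBB/(@Fsub n); rewrite /F/= in_itv/= lexx ltW.
    + apply: cvg_at_left_filter; apply: is_derive_continuous.
      by apply/dBB/(@Fsub n); rewrite /F/= in_itv/= lexx ltW.
  - move=> x; rewrite in_itv/= => /andP[x1 x2]; rewrite derive1E.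
    have [] // : is_derive x 1 B (dB x).
    by apply/dBB/(@Fsub n); rewrite /F/= in_itv/= !ltW.
have mF i : measurable (F i) by exact: measurable_itv.
have mdBF i : measurable_fun (F i) (EFin \o dB).
  apply/measurable_EFinP; apply: measurable_funS mdB; first exact: measurable_itv.
  by move=> x /Fsub; rewrite /= in_itv.
have H := ge0_nondecreasing_set_cvg_integral (mu := mu) nnF mF mdBF dB0'.
rewrite FE in H.
apply/integrableP; split; first exact/measurable_EFinP.
apply: (@le_lt_trans _ _ (C *+ 2)%:E); last exact: ltry.
rewrite [leLHS](_ : _ = \int[mu]_(x in `]a, b[) (EFin \o dB) x)%E; last first.
  apply: eq_integral => x; rewrite inE/= in_itv/= => xab.
  by rewrite ger0_norm// dB0.
rewrite -(cvg_lim _ H)//.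
by apply: lime_le; [exact: cvgP H|exact: nearW].
Qed.

End BoundedPrimitive.

(** * The perturbed flux profile *)

Section Psi.
Context {R : realType}.
Implicit Types (r t eps : R) (m : nat).

(** The modulus of the flux of the perturbed barrier at radius t; m stands for
n - 1. It is 1 at t = r, and eps = 0 gives the barrier itself. *)
Definition psi r m eps t : R := (1 - eps) * (r ^+ m / t ^+ m) + eps.

Lemma psi0E r m t : psi r m 0 t = r ^+ m / t ^+ m.
Proof. by rewrite /psi subr0 mul1r addr0. Qed.

Lemma ratio_bounds r t m : (0 < m)%N -> 0 < r -> r < t ->
  0 < r ^+ m / t ^+ m < 1.
Proof.
move=> m0 r0 rt; have t0 := lt_trans r0 rt.
rewrite divr_gt0 ?exprn_gt0//= ltr_pdivrMr ?exprn_gt0// mul1r.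
by rewrite ltrXn2r ?nnegrE ?ltW// -lt0n.
Qed.

Lemma psi_bounds r t m eps : (0 < m)%N -> 0 < r -> r < t -> 0 <= eps < 1 ->
  0 < psi r m eps t < 1.
Proof.
move=> m0 r0 rt /andP[e0 e1]; rewrite /psi; have := ratio_bounds m0 r0 rt.
by set q := _ / _ => /andP[q0 q1]; nra.
Qed.

Lemma psi_ge_psi0 r t m eps : (0 < m)%N -> 0 < r -> r < t -> 0 <= eps ->
  psi r m 0 t <= psi r m eps t <= psi r m 0 t + eps.
Proof.
move=> m0 r0 rt e0; rewrite psi0E /psi; have := ratio_bounds m0 r0 rt.
by set q := _ / _ => /andP[q0 q1]; nra.
Qed.

(** Equivalently, the divergence - psi' - m psi / t of the flux is - m eps / t. *)
Lemma is_derive_psi r t m eps : (0 < m)%N -> 0 < t ->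
  is_derive t 1 (psi r m eps) (- (m%:R * (psi r m eps t - eps) / t)).
Proof.
move=> m0 t0.
have tm0 : t ^+ m != 0 by rewrite expf_neq0// gt_eqF.
have D : is_derive t 1 (fun s : R => s ^+ m) (m%:R * t ^+ m.-1).
  apply: DeriveDef; first exact: exprn_derivable.
  by rewrite exp_derive [_ *: _]mulr1.
have DV := @is_deriveV R (fun s : R => s ^+ m) t (m%:R * t ^+ m.-1) 1 tm0 D.
have -> : psi r m eps = (fun s => ((1 - eps) * r ^+ m) *: (s ^+ m)^-1 + eps).
  by apply/funext => s; rewrite /psi mulrA.
have := is_deriveD (is_deriveZ ((1 - eps) * r ^+ m) DV) (is_derive_cst eps t 1).
move=> H; apply: is_derive_eq H _.
rewrite addr0 /GRing.scale/= addrK.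
case: m m0 tm0 {D DV} => // m _ tm0; rewrite /= !exprS; field.
by rewrite expf_neq0 ?gt_eqF.
Qed.

Lemma psi_continuous r t m eps : (0 < m)%N -> 0 < t -> {for t, continuous (psi r m eps)}.
Proof. by move=> m0 t0; exact: is_derive_continuous (is_derive_psi r eps m0 t0). Qed.

End Psi.

(** * The slope of the barrier and its integrability *)

Section Slope.
Context {R : realType} (g : R -> R) (gamma : R).
Implicit Types (s t x y M eta r eps : R) (m : nat).
Hypothesis gamma0 : 0 < gamma.
Hypothesis gC2 : C2_hoelder gamma g.
Hypothesis g2_gt0 : forall t : R, 0 <= t -> 0 < d2 g t.
Hypothesis g1_0 : d1 g 0 = 0.
Hypothesis g1_lim : d1 g t @[t --> +oo] --> (1 : R).
Notation mu := (@lebesgue_measure R).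

Section Legendre.
Hypothesis g2_int : (\int[mu]_(t in `[0%R, +oo[) (t * d2 g t)%:E < +oo)%E.

(** The Legendre transform of g, as a function of the slope variable t. *)
Definition legendre t := t * d1 g t - g t.

Lemma is_derive_legendre t : 0 < t -> is_derive t 1 legendre (t * d2 g t).
Proof.
move=> t0; have D := is_deriveB (is_deriveM (is_derive_id t (1 : R))
  (is_derive_d1 gC2 t0)) (is_derive_g gC2 t0).
by apply: is_derive_eq D _; rewrite /GRing.scale/= mulr1 addrK.
Qed.

Lemma legendre_continuous : {within `[0, +oo[, continuous legendre}.
Proof.
apply/subspace_continuousP => x x0; apply: cvgB.
  apply: cvgM; first by apply: cvg_within_filter; exact: cvg_id.
  by have /subspace_continuousP := @d1_continuous _ _ _ gC2; exact.
by have /subspace_continuousP := @g_continuous _ _ _ gC2; exact.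
Qed.

(** The derivative of [legendre] is t g''(t), which is integrable. *)
Lemma legendre_bounded : exists C, forall t, 0 < t -> `|legendre t| <= C.
Proof.
pose I := (\int[mu]_(t in `[0%R, +oo[) (t * d2 g t)%:E)%E.
have cd2 M : {within `[0, M], continuous (fun t => t * d2 g t)}.
  apply/subspace_continuousP => x xM.
  apply: cvgM; first by apply: cvg_within_filter; exact: cvg_id.
  by have /subspace_continuousP := @d2_continuous _ _ _ gamma0 gC2 M; exact.
have pos x : `[0%R, +oo[%classic x -> (0 <= (x * d2 g x)%:E)%E.
  rewrite /= in_itv/= andbT => x0; rewrite lee_fin mulr_ge0// ltW// g2_gt0//.
have I0 : (0 <= I)%E by apply: integral_ge0.
have mdf : measurable_fun `[(0%R : R), +oo[ (fun t => (t * d2 g t)%:E).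
  apply/measurable_EFinP; apply/measurable_fun_itv_obnd_cbndP.
  apply: open_continuous_measurable_fun; first exact: interval_open.
  move=> x; rewrite inE/= in_itv/= andbT => x0.
  have := cd2 (x + 1).
  have x1 : 0 < x + 1 by rewrite addr_gt0.
  move=> /(continuous_within_itvP _ x1)[+ _ _]; apply.
  by rewrite in_itv/= x0 ltrDl ltr01.
exists (fine I + `|g 0|) => t t0.
have E : (\int[mu]_(x in `[0%R, t]) (x * d2 g x)%:E = (legendre t)%:E - (legendre 0)%:E)%E.
  apply: continuous_FTC2 => //.
  - split.
    + move=> x; rewrite in_itv/= => /andP[x0 _].
      by case: (is_derive_legendre x0).
    + by have /continuous_within_itvcyP[_] := legendre_continuous.
    + apply: cvg_at_left_filter.
      exact: (is_derive_continuous (is_derive_legendre t0)).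
  - move=> x; rewrite in_itv/= => /andP[x0 _]; rewrite derive1E.
    by case: (is_derive_legendre x0).
have LI : ((legendre t)%:E - (legendre 0)%:E <= I)%E.
  rewrite -E; apply: ge0_subset_integral => //.
  by move=> x /=; rewrite !in_itv/= andbT => /andP[].
have L0 : (0 <= (legendre t)%:E - (legendre 0)%:E)%E.
  rewrite -E; apply: integral_ge0 => x /= xt; apply: pos.
  by move: xt; rewrite /= !in_itv/= andbT => /andP[].
have If : I = (fine I)%:E by rewrite fineK// ge0_fin_numE.
move: LI L0; rewrite If -EFinB !lee_fin /legendre mul0r sub0r opprK => LI L0.
by rewrite ler_norml; have := ler_norm (g 0); have := ler_norm (- g 0); rewrite normrN; lra.
Qed.

Lemma is_derive_legendre_d1inv y : 0 < y < 1 ->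
  is_derive y 1 (legendre \o d1inv g) (d1inv g y).
Proof.
move=> y01; have F0 := d1inv_gt0 gC2 g2_gt0 g1_0 g1_lim y01.
have D := is_derive1_comp (is_derive_legendre F0) (is_derive_d1inv gC2 g2_gt0 g1_0 g1_lim y01).
by apply: is_derive_eq D _; rewrite mulfK// gt_eqF// g2_gt0// ltW.
Qed.

End Legendre.

(** Absolute value of the radial derivative of the perturbed barrier. *)
Definition slope r m eps t := d1inv g (psi r m eps t).

Lemma slope_continuous r t m eps : (0 < m)%N -> 0 < r -> r < t -> 0 <= eps < 1 ->
  {for t, continuous (slope r m eps)}.
Proof.
move=> m0 r0 rt e01; apply: (@continuous_comp _ _ _ (psi r m eps) (d1inv g)).
  by apply: psi_continuous => //; exact: lt_trans rt.
exact: is_derive_continuous (is_derive_d1inv gC2 g2_gt0 g1_0 g1_lim (psi_bounds m0 r0 rt e01)).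
Qed.

Lemma slope_gt0 r t m eps : (0 < m)%N -> 0 < r -> r < t -> 0 <= eps < 1 ->
  0 < slope r m eps t.
Proof.
by move=> m0 r0 rt e01; exact: (d1inv_gt0 gC2 g2_gt0 g1_0 g1_lim (psi_bounds m0 r0 rt e01)).
Qed.

Lemma d1_slope r t m eps : (0 < m)%N -> 0 < r -> r < t -> 0 <= eps < 1 ->
  d1 g (slope r m eps t) = psi r m eps t.
Proof.
move=> m0 r0 rt e01; have /andP[p0 p1] := psi_bounds m0 r0 rt e01.
by rewrite (d1invK gC2 g2_gt0 g1_0 g1_lim)// ltW.
Qed.

Lemma slope_gt r t m eps M : (0 < m)%N -> 0 < r -> r < t -> 0 <= eps < 1 ->
  0 <= M -> d1 g M < psi r m eps t -> M < slope r m eps t.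
Proof.
move=> m0 r0 rt e01 M0; rewrite -(d1_slope m0 r0 rt e01) => H.
rewrite ltNge; apply/negP => H'.
have := d1_le gC2 g2_gt0 (ltW (slope_gt0 m0 r0 rt e01)) H'.
by rewrite leNgt H.
Qed.

(** Up to sign, the derivative of the bounded function
[legendre \o d1inv g \o psi r m 0] is the slope times the weight m psi / t, and
this weight is bounded below on ]r, rho[. *)
Lemma slope_integrable
  (g2_int : (\int[mu]_(t in `[0%R, +oo[) (t * d2 g t)%:E < +oo)%E) r rho m :
  (0 < m)%N -> 0 < r -> r < rho ->
  mu.-integrable `]r, rho[ (EFin \o slope r m 0).
Proof.
move=> m0 r0 rrho.
have [C HC] := legendre_bounded g2_int.
have e01 : 0 <= (0 : R) < 1 by rewrite lexx ltr01.
pose w t := m%:R * psi r m 0 t / t.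
have mR : 0 < m%:R :> R by rewrite ltr0n.
have wcont t : 0 < t -> {for t, continuous w}.
  move=> t0; apply: (@continuousM _ _ (fun t => m%:R * psi r m 0 t) (fun t => t^-1)).
    apply: continuousM; first exact: cst_continuous.
    exact: psi_continuous.
  by apply: inv_continuous; rewrite gt_eqF.
have : mu.-integrable `]r, rho[ (EFin \o (fun t => slope r m 0 t * w t)).
  apply: (@integrable_bounded_primitive _ _ _ C
     (- (legendre \o d1inv g \o psi r m 0)) _ rrho) => t /andP[rt trho].
  - have p01 := psi_bounds m0 r0 rt e01.
    have D := is_deriveN (is_derive1_comp (is_derive_legendre_d1inv p01)
      (is_derive_psi r 0 m0 (lt_trans r0 rt))).
    by apply: is_derive_eq D _; rewrite subr0 mulrN opprK.
  - apply: continuousM; [exact: slope_continuous|exact/wcont/(lt_trans r0)].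
  - have /andP[p0 _] := psi_bounds m0 r0 rt e01.
    have t0 := lt_trans r0 rt.
    by rewrite ltW// mulr_gt0 ?slope_gt0// /w divr_gt0 ?mulr_gt0.
  - by rewrite [X in `|X|]/= normrN; apply: HC; exact: slope_gt0.
have rho0 := lt_trans r0 rrho.
pose c := m%:R * psi r m 0 rho / rho.
have c0 : 0 < c.
  have /andP[p0 _] := psi_bounds m0 r0 rrho e01.
  by rewrite /c divr_gt0 ?mulr_gt0.
move=> H; have I : mu.-integrable `]r, rho[
    (fun t => (c^-1)%:E * (slope r m 0 t * w t)%:E)%E.
  exact: integrableZl.
apply: (le_integrable _ _ _ I) => //.
  apply/measurable_EFinP; apply: open_continuous_measurable_fun; first exact: interval_open.
  by move=> x; rewrite inE/= in_itv/= => /andP[rx _]; exact: slope_continuous.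
move=> t; rewrite /= in_itv/= => /andP[rt trho].
have s0 := slope_gt0 m0 r0 rt e01; have t0 := lt_trans r0 rt.
have cw : c <= w t.
  rewrite /c /w !psi0E -!mulrA; apply: ler_wpM2l; first exact: ltW.
  apply: ler_wpM2l; first by rewrite exprn_ge0// ltW.
  rewrite -!invfM lef_pV2 ?posrE ?mulr_gt0 ?exprn_gt0//.
  apply: ler_pM; rewrite ?exprn_ge0 ?(ltW t0)//.
    by rewrite lerXn2r ?nnegrE ?(ltW t0) ?(ltW rho0) ?(ltW trho).
  exact: ltW.
have w0 := lt_le_trans c0 cw.
have cw0 : 0 < c^-1 * (slope r m 0 t * w t).
  by apply: mulr_gt0; [rewrite invr_gt0|exact: mulr_gt0].
rewrite lee_fin (gtr0_norm s0) (gtr0_norm cw0).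
by rewrite mulrCA ler_peMr ?(ltW s0)// ler_pdivlMl// mulr1.
Qed.

End Slope.

(** * The barrier and its perturbation *)

Section Potential.
Context {R : realType} (g : R -> R) (gamma : R).
Implicit Types (s t x y M eta r eps : R) (m : nat).
Hypothesis gamma0 : 0 < gamma.
Hypothesis gC2 : C2_hoelder gamma g.
Hypothesis g2_gt0 : forall t : R, 0 <= t -> 0 < d2 g t.
Hypothesis g1_0 : d1 g 0 = 0.
Hypothesis g1_lim : d1 g t @[t --> +oo] --> (1 : R).
Notation mu := (@lebesgue_measure R).
Hypothesis g2_int : (\int[mu]_(t in `[0%R, +oo[) (t * d2 g t)%:E < +oo)%E.

Lemma slope_primitive r m eps r1 b : (0 < m)%N -> 0 < r -> r < r1 ->
  0 <= eps < 1 -> exists P : R -> R,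
    forall t, r1 < t < b -> is_derive t 1 P (slope g r m eps t).
Proof.
move=> m0 r0 rr1 e01.
have cs t : r1 <= t -> {for t, continuous (slope g r m eps)}.
  by move=> r1t; apply: (slope_continuous gC2) => //; exact: lt_le_trans r1t.
exists (fun y => \int[mu]_(t in `[r1, y]) slope g r m eps t) => t /andP[r1t tb].
have I : mu.-integrable `[r1, b] (EFin \o slope g r m eps).
  apply: continuous_compact_integrable; first exact: segment_compact.
  by apply: continuous_within_segment => x /andP[/cs].
have [D E] := continuous_FTC1_closed tb I r1t (cs _ (ltW r1t)).
by split; [exact: D|rewrite -derive1E E].
Qed.

(** The integral in the definition of the barrier, as a function of the radius. *)
Definition kint r m t : R := \int[mu]_(s in `]r, t[) slope g r m 0 s.

Lemma kint_ge0 r m t : (0 < m)%N -> 0 < r -> 0 <= kint r m t.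
Proof.
move=> m0 r0; apply: Rintegral_ge0 => s /=; rewrite in_itv/= => /andP[rs _].
by rewrite ltW// (slope_gt0 gC2)//= lexx ltr01.
Qed.

Lemma is_derive_kint r m t : (0 < m)%N -> 0 < r -> r < t ->
  is_derive t 1 (kint r m) (slope g r m 0 t).
Proof.
move=> m0 r0 rt; pose b := t + 1; have tb : t < b by rewrite ltrDl.
have I y : mu.-integrable `]r, y[ (EFin \o slope g r m 0).
  have [ry|yr] := ltP r y; first exact: (slope_integrable gamma0 gC2).
  rewrite set_itv_ge ?bnd_simp -?leNgt//; exact: integrable_set0.
have I' y : mu.-integrable `]r, y] (EFin \o slope g r m 0).
  apply: integrableS (I (y + 1)) => // s /=; rewrite !in_itv/= => /andP[-> sy]/=.
  by rewrite (le_lt_trans sy)// ltrDl.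
have E y : kint r m y = \int[mu]_(s in `]r, y]) slope g r m 0 s.
  exact: Rintegral_itv_bndo_bndc.
have -> : kint r m = (fun y => \int[mu]_(s in `]r, y]) slope g r m 0 s).
  exact/funext.
have e01 : 0 <= (0 : R) < 1 by rewrite lexx ltr01.
have cs : {for t, continuous (slope g r m 0)} by exact: (slope_continuous gC2).
have rt' : (BRight r < BRight t)%O by rewrite bnd_simp.
have [D F] := continuous_FTC1 tb (I' b) rt' cs.
by split; [apply: D|rewrite -derive1E F].
Qed.

(** Uniform control of the perturbation; it is uniform because on [t1, +oo[ the
slope of the barrier takes its values in a compact interval. *)
Lemma slope_perturbation r m t1 eta : (0 < m)%N -> 0 < r -> r < t1 -> 0 < eta ->
  exists2 eps, 0 < eps < 1 &
    forall t, t1 <= t -> slope g r m eps t <= slope g r m 0 t + eta.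
Proof.
move=> m0 r0 rt1 eta0; have e01 : 0 <= (0 : R) < 1 by rewrite lexx ltr01.
have s1 := slope_gt0 gC2 g2_gt0 g1_0 g1_lim m0 r0 rt1 e01.
have [d d0 Hd] := d1_increment gamma0 gC2 g2_gt0 eta0 (ltW s1).
pose eps := Num.min d 2^-1.
have eps0 : 0 < eps by rewrite lt_min d0 invr_gt0 ltr0n.
have eps1 : eps < 1 by rewrite gt_min invf_lt1// ltr1n orbT.
have epsd : eps <= d by rewrite ge_min lexx.
exists eps; first by rewrite eps0.
move=> t t1t; have rt := lt_le_trans rt1 t1t.
have s0 := slope_gt0 gC2 g2_gt0 g1_0 g1_lim m0 r0 rt e01.
have e01' : 0 <= eps < 1 by rewrite ltW.
have /andP[p0 p1] := psi_bounds m0 r0 rt e01.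
have /andP[q0 q1] := psi_bounds m0 r0 rt e01'.
rewrite /slope (d1inv_le_d1 gC2 g2_gt0 g1_0 g1_lim) ?(ltW q0)//; last first.
  by rewrite addr_ge0 ?ltW.
apply: le_trans (Hd _ _); last first.
  rewrite (ltW s0)/= /slope (d1inv_le_d1 gC2 g2_gt0 g1_0 g1_lim) ?(ltW p0) ?(ltW s1)//.
  rewrite (d1_slope gC2)// !psi0E ler_wpM2l ?exprn_ge0 ?(ltW r0)//.
  have t10 := lt_trans r0 rt1; have t0 := lt_trans r0 rt.
  by rewrite lef_pV2 ?posrE ?exprn_gt0// lerXn2r// nnegrE ltW.
rewrite (d1_slope gC2)//.
have /andP[_ /le_trans] := psi_ge_psi0 m0 r0 rt (ltW eps0); apply.
by rewrite lerD2l.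
Qed.

Lemma kminusE n r a (x : 'rV[R]_n) : (1 < n)%N -> 0 < r ->
  kminus g (r ^+ n.-1) a x = - kint r n.-1 (enorm x) + a.
Proof.
move=> n1 r0; rewrite /kminus.
have -> : (r ^+ n.-1) `^ (n.-1%:R^-1) = r.
  rewrite -powR_mulrn ?ltW// -powRrM mulfV ?powRr1 ?ltW//.
  by rewrite pnatr_eq0 -lt0n; case: n n1 x => [|[]].
by congr (- _ + _); rewrite /kint /slope; under [RHS]eq_Rintegral do rewrite psi0E.
Qed.

End Potential.

(** * Directional derivatives of functions with continuous partial derivatives *)

Section Directional.
Context {R : realType} {V : normedModType R}.
Implicit Types (f : V -> R) (x y v w e : V) (s c : R).

Lemma is_derive_line f y w s l : is_derive (y + s *: w) w f l ->
  is_derive s 1 (fun t : R => f (y + t *: w)) l.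
Proof.
case=> D E.
have Q : (fun h : R => h^-1 *: (((fun t : R => f (y + t *: w)) \o shift s) (h *: (1 : R))
            - f (y + s *: w))) =
         (fun h : R => h^-1 *: ((f \o shift (y + s *: w)) (h *: w) - f (y + s *: w))).
  apply/funext => h /=; congr (_ *: (f _ - _)).
  by rewrite [h%:A]mulr1 scalerDl addrCA.
split; first by rewrite /derivable Q.
by rewrite -E /derive Q.
Qed.

(** Mean value theorem along a direction, with the intermediate point written as
y + s c e so that both signs of c are covered. *)
Lemma line_MVT f y e c :
  (forall s, 0 <= s <= 1 -> derivable f (y + (s * c) *: e) e) ->
  exists2 s, 0 <= s <= 1 & f (y + c *: e) - f y = c * 'D_e f (y + (s * c) *: e).
Proof.
move=> df; pose p s := f (y + (s * c) *: e).
have dp s : 0 <= s <= 1 -> is_derive s 1 p ('D_e f (y + (s * c) *: e) * c).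
  move=> s01; have D := is_derive_line (derivableP (df _ s01)).
  have M : is_derive s 1 (fun s : R => s * c) c.
    have := is_deriveM (is_derive_id s (1 : R)) (is_derive_cst c s 1).
    by move=> H; apply: is_derive_eq H _; rewrite /GRing.scale/= mulr0 mulr1 add0r.
  have := @is_derive1_comp R (fun t => f (y + t *: e)) (fun s => s * c) s _ _ D M.
  by apply.
have cp : {within `[0, 1], continuous p}.
  apply/subspace_continuousP => s /=; rewrite in_itv/= => s01.
  have [d _] := dp s s01; apply: cvg_within_filter.
  exact: (differentiable_continuous ((derivable1_diffP _ _).1 d)).
have [|s s01 E] := MVT ltr01 (df := fun s => 'D_e f (y + (s * c) *: e) * c) _ cp.
  by move=> s; rewrite in_itv/= => /andP[s0 s1]; apply: dp; rewrite !ltW.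
exists s; first by move: s01; rewrite in_itv/= => /andP[s0 s1]; rewrite !ltW.
by move: E; rewrite /p mul1r mul0r scale0r addr0 subr0 mulr1 mulrC.
Qed.

(** Only the derivative along e has to exist near x and be continuous at x; the
derivative along v is needed at x alone, which lets one add the coordinate
directions one at a time. *)
Lemma is_derive_add f x v e c l : is_derive x v f l ->
  (\forall y \near x, derivable f y e) -> {for x, continuous ('D_e f)} ->
  is_derive x (v + c *: e) f (l + c * 'D_e f x).
Proof.
move=> [dv vE] de ce.
have H1 : h^-1 *: ((f \o shift x) (h *: v) - f x) @[h --> (0 : R)^'] --> l.
  by rewrite -vE; exact: dv.
have H2 : h^-1 *: (f ((h *: v + x) + (h * c) *: e) - f (h *: v + x))
    @[h --> (0 : R)^'] --> c * 'D_e f x.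
  apply/cvgrPdist_le => eps eps0.
  pose d := eps / (`|c| + 1).
  have c1 : 0 < `|c| + 1 by rewrite ltr_wpDl.
  have d0 : 0 < d by rewrite divr_gt0.
  have N1 : \forall y \near x, `|'D_e f x - 'D_e f y| <= d.
    by move/cvgrPdist_le : ce; exact.
  have : \forall y \near x, derivable f y e /\ `|'D_e f x - 'D_e f y| <= d.
    exact: filterI.
  move=> /nbhs_ballP[del /= del0 Hdel].
  pose B := `|v| + `|c| * `|e| + 1.
  have B0 : 0 < B by rewrite ltr_wpDl// addr_ge0// mulr_ge0.
  have N0 : \forall h \near (0 : R)^', `|h| < del / B.
    by apply: cvg_within; exact: (@pseudometric_normed_Zmodule.nbhs0_lt R R^o _ (divr_gt0 del0 B0)).
  near=> h.
  have h0 : h != 0 by near: h; exact: nbhs_dnbhs_neq.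
  have hd : `|h| * B < del by rewrite -ltr_pdivlMr//; near: h.
  have inB s : 0 <= s <= 1 -> ball x del (h *: v + x + (s * (h * c)) *: e).
    move=> /andP[s0 s1]; rewrite -ball_normE /ball_/=.
    rewrite addrAC addrC opprD addrA subrr sub0r normrN.
    rewrite (le_lt_trans _ hd)// (le_trans (ler_normD _ _))//.
    rewrite (normrZ h v) (normrZ (s * (h * c)) e) !normrM (ger0_norm s0) /B !mulrDr mulr1 -addrA lerD2l.
    apply: (@le_trans _ _ (`|h| * (`|c| * `|e|))); last by rewrite lerDl.
    rewrite !mulrA ler_wpM2r// ler_wpM2r// ler_piMl//.
  have [|s s01 ->] := @line_MVT f (h *: v + x) e (h * c).
    by move=> s /inB /Hdel[].
  have [_ Hd] := Hdel _ (inB _ s01).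
  rewrite -mulrA /GRing.scale/= mulKf// -mulrBr normrM.
  apply: (@le_trans _ _ (`|c| * d)); first by rewrite ler_wpM2l.
  by rewrite /d mulrA ler_pdivrMr// mulrC ler_wpM2l ?(ltW eps0)// lerDl.
have H := cvgD H1 H2.
have Q : (fun h : R => h^-1 *: ((f \o shift x) (h *: (v + c *: e)) - f x)) =
   (fun h : R => h^-1 *: ((f \o shift x) (h *: v) - f x)) \+
   (fun h : R => h^-1 *: (f ((h *: v + x) + (h * c) *: e) - f (h *: v + x))).
  apply/funext => h /=; rewrite -scalerDr; congr (_ *: _).
  by rewrite (scalerDr h v) scalerA addrAC [RHS]addrC addrA subrK.
split; first by rewrite /derivable Q; apply/cvg_ex; eexists; exact: H.
rewrite /derive Q; apply: cvg_lim; [exact: Rhausdorff|exact: H].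
Unshelve. all: by end_near. Qed.

End Directional.

Section SeveralVar.
Context {R : realType} {n : nat}.
Implicit Types (x v : 'rV[R]_n) (u : 'rV[R]_n -> R) (A : set 'rV[R]_n).

Lemma C1_on_is_derive A u x v : open A -> C1_on A u -> A x ->
  is_derive x v u (\sum_i v 0 i * partial i u x).
Proof.
move=> oA [_ pu] Ax; rewrite [X in is_derive x X](row_sum_delta v).
elim/big_rec2 : _ => [|i w l _ IH]; first exact: is_derive0.
rewrite addrC (addrC _ w); apply: (is_derive_add _ IH); last by have [] := pu i x Ax.
by move: oA; rewrite openE => /(_ _ Ax); apply: filterS => y /(pu i)[].
Qed.

Lemma C2_on_is_derive2 A u x v : open A -> C2_on A u -> A x ->
  is_derive (0 : R) 1 (fun s : R => \sum_i v 0 i * partial i u (x + s *: v))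
    (\sum_i \sum_j v 0 i * v 0 j * partial j (partial i u) x).
Proof.
move=> oA [_ pu] Ax.
have H i : is_derive (0 : R) 1 (fun s : R => v 0 i * partial i u (x + s *: v))
    (v 0 i * \sum_j v 0 j * partial j (partial i u) x).
  apply: (@is_deriveZ _ _ _ (fun s : R => partial i u (x + s *: v)) (v 0 i)).
  apply: is_derive_line; rewrite scale0r addr0.
  exact: C1_on_is_derive (pu i) Ax.
have := is_derive_sum H.
rewrite (_ : \sum_i _ = (fun s : R => \sum_i v 0 i * partial i u (x + s *: v))); last first.
  by apply/funext => s; rewrite fct_sumE.
move=> D; apply: is_derive_eq D _; apply: eq_bigr => i _.
by rewrite mulr_sumr; apply: eq_bigr => j _; rewrite mulrA.
Qed.

End SeveralVar.

(** * Euclidean norm, balls and shells *)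

Section Euclid.
Context {R : realType} {n : nat}.
Implicit Types (x y v : 'rV[R]_n) (a b c s : R).

(** The Euclidean scalar product. *)
Definition dot x y : R := \sum_i x 0 i * y 0 i.

Lemma enormE x : enorm x = Num.sqrt (dot x x).
Proof. by rewrite /enorm /dot; under eq_bigr do rewrite expr2. Qed.

Lemma dot_ge0 x : 0 <= dot x x.
Proof. by apply: sumr_ge0 => i _; rewrite -expr2 sqr_ge0. Qed.

Lemma enorm_ge0 x : 0 <= enorm x. Proof. exact: sqrtr_ge0. Qed.

Lemma enorm_sq x : enorm x ^+ 2 = dot x x.
Proof. by rewrite enormE sqr_sqrtr ?dot_ge0. Qed.

Lemma dotC x y : dot x y = dot y x.
Proof. by apply: eq_bigr => i _; rewrite mulrC. Qed.

Lemma dotDl x y v : dot (x + y) v = dot x v + dot y v.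
Proof. by rewrite /dot -big_split; apply: eq_bigr => i _; rewrite /= mxE mulrDl. Qed.

Lemma dotDr x y v : dot v (x + y) = dot v x + dot v y.
Proof. by rewrite dotC dotDl !(dotC v). Qed.

Lemma dotZl c x v : dot (c *: x) v = c * dot x v.
Proof. by rewrite /dot mulr_sumr; apply: eq_bigr => i _; rewrite mxE mulrA. Qed.

Lemma dotZr c x v : dot x (c *: v) = c * dot x v.
Proof. by rewrite dotC dotZl dotC. Qed.

Lemma enormZ c x : enorm (c *: x) = `|c| * enorm x.
Proof. by rewrite !enormE dotZl dotZr mulrA -expr2 sqrtrM ?sqr_ge0// sqrtr_sqr. Qed.

Lemma coord_le_enorm x i : `|x 0 i| <= enorm x.
Proof.
rewrite -sqrtr_sqr ler_wsqrtr// (bigD1 i)//= lerDl.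
by apply: sumr_ge0 => j _; rewrite sqr_ge0.
Qed.

Lemma norm_le_enorm x : `|x| <= enorm x.
Proof.
rewrite /Num.norm/= mx_normrE; apply: bigmax_le; first exact: enorm_ge0.
by move=> [i j] _ /=; rewrite ord1 coord_le_enorm.
Qed.

Lemma enorm_continuous : continuous (@enorm R n).
Proof.
have C : continuous (fun y : 'rV[R]_n => \sum_(i < n) y 0 i ^+ 2).
  apply: continuous_big => [|i _ y]; first exact: add_continuous.
  have yi : (fun y : 'rV[R]_n => y 0 i) z @[z --> y] --> y 0 i.
    exact: coord_continuous.
  exact: (cvgM yi yi).
by move=> x; apply: (continuous_comp (C x)); exact: sqrt_continuous.
Qed.

Lemma is_derive_enorm_curve (q : R -> 'rV[R]_n) (dq : 'rV[R]_n) s :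
  (forall i, is_derive s 1 (fun t : R => q t 0 i) (dq 0 i)) -> 0 < enorm (q s) ->
  is_derive s 1 (fun t : R => enorm (q t)) (dot (q s) dq / enorm (q s)).
Proof.
move=> dqi p0.
have D : is_derive s 1 (fun t : R => dot (q t) (q t)) (2 * dot (q s) dq).
  have Di i : is_derive s 1 (fun t : R => q t 0 i * q t 0 i) (2 * (q s 0 i * dq 0 i)).
    have H := is_deriveM (dqi i) (dqi i); apply: is_derive_eq H _.
    by rewrite /GRing.scale/=; ring.
  have := is_derive_sum Di.
  rewrite (_ : \sum_i _ = (fun t : R => dot (q t) (q t))); last first.
    by apply/funext => t; rewrite fct_sumE.
  by move=> H; apply: is_derive_eq H _; rewrite -mulr_sumr.
have -> : (fun t : R => enorm (q t)) = Num.sqrt \o (fun t : R => dot (q t) (q t)).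
  by apply/funext => t /=; rewrite enormE.
have S : is_derive (dot (q s) (q s)) 1 Num.sqrt (2 * enorm (q s))^-1.
  by rewrite enormE; apply: is_derive1_sqrt; rewrite -enorm_sq exprn_gt0.
have H := @is_derive1_comp R _ _ s _ _ S D.
apply: is_derive_eq H _; rewrite invfM mulrACA mulVf ?mul1r ?pnatr_eq0//.
by rewrite mulrC.
Qed.

Lemma is_derive_coord_line x v s i :
  is_derive s 1 (fun t : R => (x + t *: v) 0 i) (v 0 i).
Proof.
have -> : (fun t : R => (x + t *: v) 0 i) = (fun t => x 0 i + t *: v 0 i).
  by apply/funext => t; rewrite !mxE.
have H := is_deriveD (is_derive_cst (x 0 i) s (1 : R))
  (is_deriveM (is_derive_id s (1 : R)) (is_derive_cst (v 0 i) s 1)).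
by apply: is_derive_eq H _; rewrite /GRing.scale/= mulr0 mulr1 !add0r.
Qed.

Lemma is_derive_enorm_line x v s : 0 < enorm (x + s *: v) ->
  is_derive s 1 (fun t : R => enorm (x + t *: v))
    (dot (x + s *: v) v / enorm (x + s *: v)).
Proof.
by move=> p0; apply: is_derive_enorm_curve p0 => i; exact: is_derive_coord_line.
Qed.

Lemma is_derive_dot_line x v s :
  is_derive s 1 (fun t : R => dot (x + t *: v) v) (dot v v).
Proof.
have H := is_derive_sum (fun i => is_deriveM (is_derive_coord_line x v s i)
  (is_derive_cst (v 0 i) s 1)).
rewrite (_ : \sum_i _ = (fun t : R => dot (x + t *: v) v)) in H; last first.
  by apply/funext => t; rewrite fct_sumE.
apply: is_derive_eq H _; apply: eq_bigr => i _.
by rewrite /GRing.scale/= mulr0 add0r.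
Qed.

(** The open spherical shell, including the punctured ball when a = 0. *)
Definition shell a b : set 'rV[R]_n := [set x | a < enorm x < b].

Lemma shell_open a b : open (shell a b).
Proof.
have -> : shell a b = @enorm R n @^-1` `]a, b[.
  by apply/seteqP; split => x; rewrite /shell/= in_itv.
by apply: open_comp; [move=> x _; exact: enorm_continuous|exact: interval_open].
Qed.

Lemma closed_shell_closed a b : closed [set x : 'rV[R]_n | a <= enorm x <= b].
Proof.
have -> : [set x : 'rV[R]_n | a <= enorm x <= b] = @enorm R n @^-1` `[a, b].
  by apply/seteqP; split => x /=; rewrite in_itv.
by apply: closed_comp; [move=> x _; exact: enorm_continuous|exact: interval_closed].
Qed.

Lemma bounded_closed_rV_compact a (A : set 'rV[R]_n) : closed A ->
  (forall x, A x -> enorm x <= a) -> compact A.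
Proof.
move=> cA bA; apply: bounded_closed_compact => //.
exists a; split; first by rewrite num_real.
by move=> b ab x /bA /(le_trans (norm_le_enorm x)) /le_trans; apply; exact: ltW.
Qed.

Lemma closure_shell a b x : 0 <= a < b -> 0 < enorm x -> a <= enorm x <= b ->
  closure (shell a b) x.
Proof.
move=> /andP[a0 ab] x0 /andP[ax xb] B Bx.
pose c s := 1 + s * ((a + b) / 2 / enorm x - 1).
have cx : c s *: x @[s --> (0 : R)] --> x.
  rewrite -[X in _ --> X](_ : c 0 *: x = x); last by rewrite /c mul0r addr0 scale1r.
  apply: cvgZr_tmp; apply: cvgD; first exact: cvg_cst.
  by apply: cvgMl; exact: cvg_id.
have N : \forall s \near (0 : R)^'+, B (c s *: x).
  by apply: cvg_within; apply: cx.
near (0 : R)^'+ => s.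
have s0 : 0 < s by near: s; exact: nbhs_right_gt.
have s1 : s < 1 by near: s; exact: nbhs_right_lt.
exists (c s *: x); split; last by near: s.
have E : c s * enorm x = (1 - s) * enorm x + s * ((a + b) / 2).
  by rewrite /c; field; rewrite gt_eqF.
have p0 : 0 < c s * enorm x by rewrite E; nra.
have c0 : 0 < c s by move: p0; rewrite pmulr_lgt0.
by rewrite /shell/= enormZ (gtr0_norm c0) E; nra.
Unshelve. all: by end_near. Qed.

Lemma closure_eball a : 0 < a -> closure (eball a) = [set x : 'rV[R]_n | enorm x <= a].
Proof.
move=> a0; apply/seteqP; split => x /=.
  have C : closed [set x : 'rV[R]_n | -1 <= enorm x <= a] by exact: closed_shell_closed.
  move=> Hx; have /andP[_ //] : -1 <= enorm x <= a.
  apply: C; apply: closure_subset Hx => y /ltW ya /=.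
  by rewrite ya andbT (le_trans _ (enorm_ge0 y))// lerN10.
move=> xa; have := enorm_ge0 x; rewrite le_eqVlt => /orP[/eqP x0|x0].
  by apply: subset_closure; rewrite /eball/= -x0.
have /closure_subset : shell 0 a `<=` eball a by move=> y /andP[].
by apply; apply: closure_shell; rewrite ?lexx ?(ltW x0).
Qed.

Lemma annulusE a b : 0 < a -> annulus a b = shell a b.
Proof.
move=> a0; rewrite /annulus closure_eball//; apply/seteqP; split => x.
  by move=> [xb /negP]; rewrite -ltNge /shell/= => ->.
by move=> /andP[ax xb]; split => //=; apply/negP; rewrite -ltNge.
Qed.

Lemma closure_annulus a b : 0 < a < b ->
  closure (annulus a b) = [set x : 'rV[R]_n | a <= enorm x <= b].
Proof.
move=> /andP[a0 ab]; rewrite annulusE//; apply/seteqP; split => x /=.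
  move=> Hx; apply: closed_shell_closed; apply: closure_subset Hx => y /andP[? ?].
  by rewrite /= !ltW.
move=> /andP[ax xb]; apply: closure_shell; rewrite ?(ltW a0) ?ax//.
exact: lt_le_trans ax.
Qed.

Lemma boundary_eball b x : 0 < b -> enorm x = b -> boundary (eball b) x.
Proof.
move=> b0 xb; split; first by rewrite closure_eball//= xb.
have /closure_subset : shell b (b + 1) `<=` ~` eball b.
  by move=> y /andP[yb _]; rewrite /eball/=; apply/negP; rewrite -leNgt ltW.
rewrite closure_setC; apply; apply: closure_shell.
- by rewrite ltW// ltrDl ltr01.
- by rewrite xb.
- by rewrite xb lexx lerDl ler01.
Qed.

End Euclid.

(** * Touching from above by a radial function *)

Section MaxTest.
Context {R : realType}.

(** A function with a positive derivative at 0 exceeds its value at 0 on the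
right. *)
Lemma derive_gt0_right (F : R -> R) (L : R) : is_derive (0 : R) 1 F L -> 0 < L ->
  exists2 e, 0 < e & forall s, 0 < s < e -> F 0 < F s.
Proof.
move=> [dd E] L0.
have Q : h^-1 *: ((F \o shift 0) (h *: (1 : R)) - F 0) @[h --> (0 : R)^'] --> L.
  by rewrite -E; exact: dd.
have [e /= e0 He] := cvgr_gt _ Q 0 L0.
exists e => // s /andP[s0 se]; have : 0 < s^-1 * (F s - F 0).
  have := He s; rewrite /= sub0r normrN gtr0_norm// => /(_ se).
  by rewrite gt_eqF// addr0 [s%:A]mulr1; apply.
by rewrite pmulr_rgt0 ?invr_gt0// subr_gt0.
Qed.

(** First and second order necessary conditions at a local maximum. *)
Lemma second_derivative_at_max (F dF : R -> R) (L : R) :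
  (\forall s \near (0 : R), is_derive (s : R) 1 F (dF s)) ->
  is_derive (0 : R) 1 dF L ->
  (\forall s \near (0 : R), F s <= F 0) -> dF 0 = 0 /\ L <= 0.
Proof.
move=> FD dFD Fmax.
have : \forall s \near (0 : R), is_derive (s : R) 1 F (dF s) /\ F s <= F 0 by exact: filterI.
move=> /nbhs_ballP[d /= d0 Hd].
have Hd' (s : R) : - d < s < d -> is_derive (s : R) 1 F (dF s) /\ F s <= F 0.
  move=> sd; apply: Hd; rewrite -ball_normE /ball_/= sub0r normrN ltr_norml//.
have dF0 : dF 0 = 0.
  have [_ E] : is_derive (0 : R) 1 F 0.
    apply: (@derive1_at_max _ F (- d) d).
    - lra.
    - by move=> t; rewrite in_itv/= => /Hd'[[]].
    - by rewrite in_itv/= oppr_lt0 d0.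
    - by move=> t; rewrite in_itv/= => /Hd'[].
  have [[_ <-] _] : is_derive (0 : R) 1 F (dF 0) /\ F 0 <= F 0.
    by apply: Hd'; rewrite oppr_lt0 d0.
  by rewrite E.
split=> //; rewrite leNgt; apply/negP => L0.
have [e e0] := derive_gt0_right dFD L0; rewrite dF0 => He.
pose b := Num.min d e / 2.
have m0 : 0 < Num.min d e by rewrite lt_min d0 e0.
have md : Num.min d e <= d by rewrite ge_min lexx.
have me : Num.min d e <= e by rewrite ge_min lexx orbT.
have b0 : 0 < b by rewrite divr_gt0.
have bm : b < Num.min d e by rewrite /b; lra.
have Db x : x \in `]0, b[ -> is_derive x 1 F (dF x).
  by rewrite in_itv/= => /andP[x0 xb]; apply: (Hd' x _).1; lra.
have Cb : {within `[0, b], continuous F}.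
  apply: continuous_within_segment => x /andP[x0 xb].
  by apply: is_derive_continuous (Hd' x _).1; lra.
have [c] := MVT b0 Db Cb.
rewrite in_itv/= => /andP[c0 cb] E.
have : 0 < F b - F 0 by rewrite E subr0 mulr_gt0// He// c0/=; lra.
have [_] : is_derive b 1 F (dF b) /\ F b <= F 0 by apply: Hd'; lra.
lra.
Qed.

End MaxTest.

Section Interior.
Context {R : realType} {n : nat}.
Implicit Types (x v : 'rV[R]_n) (u : 'rV[R]_n -> R) (A : set 'rV[R]_n).

(** The Hessian quadratic form of u at x, evaluated at v. *)
Definition hess u x v : R :=
  \sum_i \sum_j v 0 i * v 0 j * partial j (partial i u) x.

(** Necessary conditions, along the line directed by v, for u + P(|.|) to have a
local maximum at x; sg and l are the first and second derivatives of P. *)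
Lemma radial_touching A u x (P sg : R -> R) (l : R) v : open A -> C2_on A u -> A x ->
  0 < enorm x ->
  (\forall s \near enorm x, is_derive (s : R) 1 P (sg s)) ->
  is_derive (enorm x) 1 sg l ->
  (\forall y \near x, u y + P (enorm y) <= u x + P (enorm x)) ->
  \sum_i v 0 i * partial i u x + sg (enorm x) * (dot x v / enorm x) = 0 /\
  hess u x v + (l * (dot x v / enorm x) ^+ 2
    + sg (enorm x) * (dot v v / enorm x - dot x v ^+ 2 / enorm x ^+ 3)) <= 0.
Proof.
move=> oA uC2 Ax x0 PD sgD umax.
pose N s := enorm (x + s *: v).
pose F s := u (x + s *: v) + P (N s).
pose dF s := \sum_i v 0 i * partial i u (x + s *: v) + sg (N s) * (dot (x + s *: v) v / N s).
have N0 : N 0 = enorm x by rewrite /N scale0r addr0.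
have lineC : (x + s *: v) @[s --> (0 : R)] --> x.
  rewrite -[X in _ --> X]addr0 -(scale0r v); apply: cvgD; first exact: cvg_cst.
  by apply: cvgZr_tmp; exact: cvg_id.
have NC : N s @[s --> (0 : R)] --> enorm x.
  by apply: (cvg_comp _ _ lineC); exact: enorm_continuous.
have nA : \forall s \near (0 : R), A (x + s *: v).
  by have nbA : nbhs x A := open_nbhs_nbhs (conj oA Ax); exact: lineC nbA.
have nN : \forall s \near (0 : R), 0 < N s by exact: (cvgr_gt _ NC).
have nP : \forall s \near (0 : R), is_derive (N s) 1 P (sg (N s)) := NC _ PD.
have nM : \forall s \near (0 : R), F s <= F 0.
  by rewrite /F N0 scale0r addr0; exact: (lineC _ umax).
have FD : \forall s \near (0 : R), is_derive (s : R) 1 F (dF s).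
  near=> s.
  have As : A (x + s *: v) by near: s.
  have Ns : 0 < N s by near: s.
  have Ps : is_derive (N s) 1 P (sg (N s)) by near: s.
  have D1 := is_derive_line (C1_on_is_derive v oA uC2.1 As).
  have D2 := @is_derive1_comp R P N s _ _ Ps (is_derive_enorm_line Ns).
  exact: is_deriveD D1 D2.
have dFD : is_derive (0 : R) 1 dF (hess u x v + (l * (dot x v / enorm x) ^+ 2
    + sg (enorm x) * (dot v v / enorm x - dot x v ^+ 2 / enorm x ^+ 3))).
  have D1 := C2_on_is_derive2 v oA uC2 Ax.
  have Np : 0 < N 0 by rewrite N0.
  have DN : is_derive (0 : R) 1 N (dot (x + 0 *: v) v / N 0) := is_derive_enorm_line Np.
  have sgD' : is_derive (N 0) 1 sg l by rewrite N0.
  have D2 := @is_derive1_comp R sg N 0 _ _ sgD' DN.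
  have Nn : N 0 != 0 by rewrite gt_eqF.
  have D3 := is_deriveV Nn DN.
  have D := is_deriveD D1 (is_derive_mul D2 (is_derive_mul (is_derive_dot_line x v 0) D3)).
  apply: is_derive_eq D _; congr (_ + _).
  rewrite /= N0 !scale0r !addr0 /GRing.scale/=; field.
  by rewrite gt_eqF.
have [E L] := second_derivative_at_max FD dFD nM.
by split=> //; move: E; rewrite /dF N0 scale0r addr0.
Unshelve. all: by end_near. Qed.

Lemma is_derive_of_line u x v l :
  is_derive (0 : R) 1 (fun t : R => u (x + t *: v)) l -> is_derive x v u l.
Proof.
case=> D E.
have Q : (fun h : R => h^-1 *: (((fun t : R => u (x + t *: v)) \o shift 0) (h *: (1 : R))
            - u (x + 0 *: v))) =
         (fun h : R => h^-1 *: ((u \o shift x) (h *: v) - u x)).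
  apply/funext => h /=; congr (_ *: (u _ - u _)).
    by rewrite [h%:A]mulr1 addr0 addrC.
  by rewrite scale0r addr0.
split; first by rewrite /derivable -Q.
by rewrite -E /derive -Q.
Qed.

(** The chain rule for the flux: the tangential part of the Hessian is weighted by
g'(q) / q and the part along the gradient by g''(q). *)
Lemma divergence_flux A (g : R -> R) u x (l : R) : open A -> C2_on A u -> A x ->
  let p := grad u x in let q := enorm p in
  0 < q -> is_derive q 1 (d1 g) l ->
  divergence (flux g u) x =
    (d1 g q / q) * (\sum_i partial i (partial i u) x - hess u x p / q ^+ 2)
    + l * (hess u x p / q ^+ 2).
Proof.
move=> oA uC2 Ax p q q0 gD.
have qn : q != 0 by rewrite gt_eqF.
have H i : partial i (fun y => flux g u y 0 i) x =
   (l / q ^+ 2 - d1 g q / q ^+ 3) * (p 0 i * \sum_j p 0 j * partial i (partial j u) x)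
   + d1 g q / q * partial i (partial i u) x.
  pose e : 'rV[R]_n := delta_mx 0 i.
  pose c (t : R) := grad u (x + t *: e).
  have c0 : c 0 = p by rewrite /c scale0r addr0.
  pose dc : 'rV[R]_n := \row_j partial i (partial j u) x.
  have Dc j : is_derive (0 : R) 1 (fun t : R => c t 0 j) (dc 0 j).
    rewrite (_ : (fun t : R => c t 0 j) = (fun t => partial j u (x + t *: e))); last first.
      by apply/funext => t; rewrite mxE.
    apply: is_derive_line; rewrite scale0r addr0 mxE; apply: derivableP.
    by have [_ /(_ i x Ax)[]] := uC2.2 j.
  have cq : 0 < enorm (c 0) by rewrite c0.
  have DN := is_derive_enorm_curve Dc cq.
  have gD' : is_derive (enorm (c 0)) 1 (d1 g) l by rewrite c0.
  have Dg := @is_derive1_comp R (d1 g) (fun t => enorm (c t)) 0 _ _ gD' DN.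
  have cn : enorm (c 0) != 0 by rewrite gt_eqF.
  have DV := @is_deriveV R (fun t => enorm (c t)) 0 _ 1 cn DN.
  have D := is_derive_mul (is_derive_mul Dg DV) (Dc i).
  have D' : is_derive x e (fun y => flux g u y 0 i)
     ((l / q ^+ 2 - d1 g q / q ^+ 3) * (p 0 i * \sum_j p 0 j * partial i (partial j u) x)
      + d1 g q / q * partial i (partial i u) x).
    apply: is_derive_of_line.
    rewrite (_ : (fun t : R => flux g u (x + t *: e) 0 i) =
       (fun t => (d1 g (enorm (c t)) / enorm (c t)) * c t 0 i)); last first.
      by apply/funext => t; rewrite /flux mxE.
    apply: is_derive_eq D _; rewrite /GRing.scale/= c0 -/q [dc 0 i]mxE.
    rewrite (_ : dot p dc = \sum_j p 0 j * partial i (partial j u) x); last first.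
      by apply: eq_bigr => j _; rewrite [dc 0 j]mxE.
    move: (\sum_(j < n) _) (partial i (partial i u) x) (p 0 i) (d1 g q) => S T P G.
    by move: (q) qn => q' qn'; clear -qn'; field.
  exact: (@derive_val _ _ _ _ _ _ _ D').
clearbody q; clear gD q0; clearbody p.
transitivity (\sum_i ((l / q ^+ 2 - d1 g q / q ^+ 3)
    * (p 0 i * \sum_j p 0 j * partial i (partial j u) x)
   + d1 g q / q * partial i (partial i u) x)).
  by apply: eq_bigr => i _; exact: H.
have lin (a b : R) (F G : 'I_n -> R) :
    \sum_i (a * F i + b * G i) = a * \sum_i F i + b * \sum_i G i.
  by rewrite big_split/= -!mulr_sumr.
rewrite (lin _ _ (fun i => p 0 i * \sum_j p 0 j * partial i (partial j u) x)
  (fun i => partial i (partial i u) x)).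
rewrite (_ : \sum_i (p 0 i * _) = hess u x p); last first.
  rewrite /hess [RHS]exchange_big/=; apply: eq_bigr => i _.
  by rewrite mulr_sumr; apply: eq_bigr => j _; ring.
move: (\sum_(i < n) _) (hess u x p) (d1 g q) => S T G.
by move: (q) qn => q' qn'; clear -qn'; field.
Qed.

(** Trace of the Hessian on the orthogonal of a unit vector, through the
projections of the canonical basis vectors. *)
Lemma hess_frame u x (nu : 'rV[R]_n) : dot nu nu = 1 ->
  \sum_k hess u x (delta_mx 0 k - nu 0 k *: nu) =
  \sum_i partial i (partial i u) x - hess u x nu.
Proof.
move=> nu1.
pose w k i : R := (i == k)%:R - nu 0 k * nu 0 i.
have wE k i : (delta_mx 0 k - nu 0 k *: nu) 0 i = w k i.
  by rewrite !mxE eqxx.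
have K i j : \sum_k w k i * w k j = (i == j)%:R - nu 0 i * nu 0 j.
  have -> : \sum_k w k i * w k j = \sum_k ((i == k)%:R * (j == k)%:R
      - nu 0 j * ((i == k)%:R * nu 0 k) - nu 0 i * ((j == k)%:R * nu 0 k)
      + nu 0 i * nu 0 j * (nu 0 k * nu 0 k)).
    by apply: eq_bigr => k _; rewrite /w; ring.
  have S (f : 'I_n -> R) a : \sum_k (a == k)%:R * f k = f a.
    rewrite (bigD1 a)//= eqxx mul1r big1 ?addr0// => k ka.
    by rewrite eq_sym (negbTE ka) mul0r.
  rewrite !big_split/= !sumrN -!mulr_sumr !S -/(dot nu nu) nu1 mulr1 eq_sym; ring.
rewrite /hess exchange_big/= -sumrB; apply: eq_bigr => i _.
rewrite exchange_big/=.
under eq_bigr => j _.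
  under eq_bigr => k _ do rewrite !wE.
  rewrite -mulr_suml K mulrBl; over.
rewrite big_split/= sumrN; congr (_ - _).
rewrite (bigD1 i)//= eqxx mul1r big1 ?addr0// => j ji.
by rewrite eq_sym (negbTE ji) mul0r.
Qed.

Lemma sum_delta (i : 'I_n) (f : 'I_n -> R) :
  \sum_j (delta_mx 0 i : 'rV[R]_n) 0 j * f j = f i.
Proof.
rewrite (bigD1 i)//= mxE !eqxx mul1r big1 ?addr0// => j ji.
by rewrite mxE (negbTE ji) andbF mul0r.
Qed.

Lemma hessZ u x c v : hess u x (c *: v) = c ^+ 2 * hess u x v.
Proof.
rewrite /hess mulr_sumr; apply: eq_bigr => i _; rewrite mulr_sumr.
by apply: eq_bigr => j _; rewrite !mxE; ring.
Qed.

End Interior.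

(** * No interior contact with the perturbed barrier *)

Section Comparison.
Context {R : realType} {n : nat} (g : R -> R) (gamma : R).
Implicit Types (s t M eta r eps : R) (m : nat) (x v : 'rV[R]_n)
  (u : 'rV[R]_n -> R) (A : set 'rV[R]_n).
Hypothesis n_ge2 : (2 <= n)%N.
Hypothesis gamma0 : 0 < gamma.
Hypothesis gC2 : C2_hoelder gamma g.
Hypothesis g2_gt0 : forall t : R, 0 <= t -> 0 < d2 g t.
Hypothesis g1_0 : d1 g 0 = 0.
Hypothesis g1_lim : d1 g t @[t --> +oo] --> (1 : R).

Let m_gt0 : (0 < n.-1)%N. Proof. by case: n n_ge2 => [|[]]. Qed.

(** The perturbed barrier is - P(|.|) up to a constant. *)
Lemma no_interior_touching A u x r eps (P : R -> R) : open A -> C2_on A u -> A x ->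
  divergence (flux g u) x = 0 -> 0 < r < enorm x -> 0 < eps < 1 ->
  (\forall s \near enorm x, is_derive (s : R) 1 P (slope g r n.-1 eps s)) ->
  ~ (\forall y \near x, u y + P (enorm y) <= u x + P (enorm x)).
Proof.
move=> oA uC2 Ax div0 /andP[r0 rt] /andP[e0 e1] PD umax.
set t := enorm x in rt PD umax; have t0 : 0 < t := lt_trans r0 rt.
have tn : t != 0 by rewrite gt_eqF.
have e01 : 0 <= eps < 1 by rewrite ltW.
have p01 := psi_bounds m_gt0 r0 rt e01.
pose sg := slope g r n.-1 eps t.
have sg0 : 0 < sg := slope_gt0 gC2 g2_gt0 g1_0 g1_lim m_gt0 r0 rt e01.
have sgn : sg != 0 by rewrite gt_eqF.
have g1sg : d1 g sg = psi r n.-1 eps t := d1_slope gC2 g2_gt0 g1_0 g1_lim m_gt0 r0 rt e01.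
pose ps' := - (n.-1%:R * (psi r n.-1 eps t - eps) / t).
have slD := is_derive1_comp (is_derive_d1inv gC2 g2_gt0 g1_0 g1_lim p01)
  (is_derive_psi r eps m_gt0 t0).
rewrite -/(slope g r n.-1 eps t) -/sg -/ps' in slD.
have slD' : is_derive (enorm x) 1 (slope g r n.-1 eps) ((d2 g sg)^-1 * ps') := slD.
have touch v := radial_touching v oA uC2 Ax t0 PD slD' umax.
have g2p : 0 < d2 g sg by apply: g2_gt0; exact: ltW.
have g2n : d2 g sg != 0 by rewrite gt_eqF.
set l := (d2 g sg)^-1 * ps' in touch.
pose nu := t^-1 *: x.
have xnu : x = t *: nu by rewrite /nu scalerA mulfV// scale1r.
have nunu : dot nu nu = 1.
  by rewrite /nu dotZl dotZr -enorm_sq -/t; field.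
have gradE : grad u x = - sg *: nu.
  apply/rowP => i; rewrite !mxE.
  have [+ _] := touch (delta_mx 0 i); rewrite sum_delta.
  have -> : dot x (delta_mx 0 i) = x 0 i by rewrite dotC /dot sum_delta.
  rewrite -/t -/sg => /eqP; rewrite addr_eq0 => /eqP ->.
  by rewrite mulNr (mulrC (x 0 i)).
have gradN : enorm (grad u x) = sg.
  by rewrite gradE enormZ normrN (gtr0_norm sg0) enormE nunu sqrtr1 mulr1.
have gD : is_derive (enorm (grad u x)) 1 (d1 g) (d2 g sg).
  by rewrite gradN; exact: (is_derive_d1 gC2).
have q0 : 0 < enorm (grad u x) by rewrite gradN.
have := divergence_flux oA uC2 Ax q0 gD; rewrite div0 gradN gradE hessZ.
rewrite sqrrN [sg ^+ 2 * _]mulrC mulfK ?expf_neq0// g1sg => D.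
(* Along nu the Euclidean norm is affine: the curvature term vanishes. *)
have Lnu : hess u x nu + l <= 0.
  have [_] := touch nu; rewrite -/t -/sg.
  have -> : dot x nu = t by rewrite xnu dotZl nunu mulr1.
  rewrite nunu; congr (_ + _ <= _); field; exact: tn.
(* The projections of the basis vectors are orthogonal to x, hence only the
   curvature of the spheres contributes; their square norms add up to n - 1. *)
have Lperp : \sum_i partial i (partial i u) x - hess u x nu + sg * n.-1%:R / t <= 0.
  rewrite -hess_frame//.
  pose w k : 'rV[R]_n := delta_mx 0 k - nu 0 k *: nu.
  have dk k : dot nu (delta_mx 0 k) = nu 0 k by rewrite dotC /dot sum_delta.
  have kk k : dot (delta_mx 0 k : 'rV[R]_n) (delta_mx 0 k) = 1.
    by rewrite /dot sum_delta mxE !eqxx.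
  have wE k : w k = delta_mx 0 k + (- nu 0 k) *: nu by rewrite /w scaleNr.
  have nuw k : dot nu (w k) = 0.
    by rewrite wE dotDr dotZr nunu dk mulr1 subrr.
  have xw k : dot x (w k) = 0 by rewrite xnu dotZl nuw mulr0.
  have ww k : dot (w k) (w k) = 1 - nu 0 k ^+ 2.
    rewrite {1}wE dotDl dotZl nuw mulr0 addr0 wE dotDr dotZr kk dotC dk; ring.
  have sw : \sum_k dot (w k) (w k) = n.-1%:R.
    under eq_bigr do rewrite ww.
    rewrite sumrB sumr_const card_ord.
    rewrite (_ : \sum_i nu 0 i ^+ 2 = 1); last first.
      by rewrite -nunu; apply: eq_bigr => i _; rewrite expr2.
    by rewrite -[in RHS]subn1 natrB//; exact: ltnW.
  rewrite -sw mulr_sumr mulr_suml -big_split/=; apply: sumr_le0 => k _.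
  have [_] := touch (w k); rewrite -/t -/sg xw -/(w k).
  by congr (_ + _ <= _); field; exact: tn.
have /andP[ps0 _] := p01.
have m0R : 0 < n.-1%:R :> R by rewrite ltr0n.
(* Both parts of the divergence are compared with those of the barrier. *)
have H1 : d2 g sg * hess u x nu <= - ps'.
  have : d2 g sg * (hess u x nu + l) <= 0 by rewrite pmulr_rle0.
  by rewrite mulrDr /l mulVKf// -lerBrDr sub0r.
set T := \sum_i _ - _ in D Lperp.
have H2 : psi r n.-1 eps t / sg * T <= - (psi r n.-1 eps t * n.-1%:R / t).
  have : psi r n.-1 eps t / sg * (T + sg * n.-1%:R / t) <= 0.
    by rewrite pmulr_rle0// divr_gt0.
  rewrite mulrDr -lerBrDr sub0r => /le_trans; apply.
  by rewrite le_eqVlt; apply/orP; left; apply/eqP; congr (- _); field; rewrite sgn tn.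
have : psi r n.-1 eps t / sg * T + d2 g sg * hess u x nu < 0.
  apply: le_lt_trans (lerD H2 H1) _.
  have -> : - (psi r n.-1 eps t * n.-1%:R / t) - ps' = - (n.-1%:R * eps / t).
    by rewrite /ps'; field.
  by rewrite oppr_lt0 divr_gt0// mulr_gt0.
by rewrite -D ltxx.
Qed.

End Comparison.

(** * The comparison theorem *)

Section Bound.
Context {R : realType} {n : nat}.
Implicit Types (u : 'rV[R]_n -> R) (A : set 'rV[R]_n).

(** Boundedness of the gradient up to the boundary, in the form of a bound on the
derivatives along vectors with coordinates in [-1, 1]. *)
Lemma partial_bounded A u : compact (closure A) -> C1_on_closure A u ->
  exists2 M, 0 <= M & forall x (v : 'rV[R]_n), A x -> (forall i, `|v 0 i| <= 1) ->
    `|\sum_i v 0 i * partial i u x| <= M.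
Proof.
move=> cA [_ _ ext].
have [A0|/set0P[a Aa]] := eqVneq A set0.
  by exists 0 => // x v; rewrite A0.
have bound i : {M | forall x, A x -> `|partial i u x| <= M}.
  apply: cid; have [v [vc vE]] := ext i.
  have vc' : {within closure A, continuous (fun x => `|v x|)}.
    apply/subspace_continuousP => x Ax; apply: cvg_norm.
    by have /subspace_continuousP := vc; apply.
  have [|c _ Hc] := EVT_max_rV _ cA vc'; first by exists a; exact: subset_closure.
  exists `|v c| => x Ax; rewrite -vE ?inE//; apply: Hc; rewrite inE.
  exact: subset_closure.
exists (\sum_i projT1 (bound i)).
  apply: sumr_ge0 => i _; apply: le_trans (projT2 (bound i) a Aa); exact: normr_ge0.
move=> x v Ax v1; rewrite (le_trans (ler_norm_sum _ _ _))//.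
apply: ler_sum => i _; rewrite normrM.
apply: (@le_trans _ _ `|partial i u x|); first by rewrite ler_piMl.
exact: (projT2 (bound i)).
Qed.

End Bound.

Theorem lemma3 (R : realType) (n : nat) (n_ge2 : (2 <= n)%N)
  (g : R -> R) (gamma : R) (gamma01 : 0 < gamma < 1)
  (g_C2 : C2_hoelder gamma g)
  (g_lin : exists c1 C1 c2 C2 : R,
     [/\ 0 < c1, 0 < C1, 0 <= c2, 0 <= C2 &
         forall t, 0 <= t -> c1 * t - c2 <= g t <= C1 * t + C2])
  (g2_gt0 : forall t, 0 <= t -> 0 < d2 g t)
  (g1_0 : d1 g 0 = 0)
  (g2_int : (\int[lebesgue_measure]_(t in `[0%R, +oo[) (t * d2 g t)%:E < +oo)%E)
  (g1_lim : d1 g t @[t --> +oo] --> (1 : R))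
  (r rho : R) (r_gt0 : 0 < r) (r_lt_rho : r < rho)
  (u : 'rV[R]_n -> R)
  (u_C2 : C2_on (annulus r rho) u)
  (u_C1 : C1_on_closure (annulus r rho) u)
  (u_sol : forall x, annulus r rho x -> divergence (flux g u) x = 0)
  (alpha : R) (alphaE : alpha = r ^+ n.-1) (a : R)
  (u_le : forall x, boundary (eball rho) x -> u x <= kminus g alpha a x) :
  forall x, closure (annulus r rho) x -> u x <= kminus g alpha a x.
Proof.
have /andP[gamma0 _] := gamma01.
have m0 : (0 < n.-1)%N by case: n n_ge2 {u u_C2 u_C1 u_sol alphaE u_le} => [|[]].
have rho0 := lt_trans r_gt0 r_lt_rho.
have rrho : 0 < r < rho by rewrite r_gt0.
have e00 : 0 <= (0 : R) < 1 by rewrite lexx ltr01.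
pose D : set 'rV[R]_n := annulus r rho.
have DE : D = shell r rho by exact: annulusE.
have clD : closure D = [set x | r <= enorm x <= rho] by exact: closure_annulus.
have oD : open D by rewrite DE; exact: shell_open.
have cptD : compact (closure D).
  apply: (@bounded_closed_rV_compact _ _ rho); first exact: closed_closure.
  by move=> x; rewrite clD => /andP[].
have kE (x : 'rV[R]_n) : kminus g alpha a x = - kint g r n.-1 (enorm x) + a.
  by rewrite alphaE kminusE.
have uc : {within closure D, continuous u} by case: u_C1.
have [M M0 HM] := partial_bounded cptD u_C1.
have outer (x : 'rV[R]_n) : enorm x = rho -> u x <= - kint g r n.-1 rho + a.
  by move=> xr; rewrite -{1}xr -kE; apply: u_le; exact: boundary_eball.
have inner (x1 : 'rV[R]_n) : r < enorm x1 < rho -> u x1 <= - kint g r n.-1 (enorm x1) + a.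
  move=> /andP[rt1 t1rho]; rewrite leNgt; apply/negP.
  set t1 := enorm x1 in rt1 t1rho *; rewrite -subr_gt0; set gap := _ - _ => gap0.
  have dist0 : 0 < rho - t1 by rewrite subr_gt0.
  (* This perturbation of the slope changes the barrier at t1 by gap / 2 at most. *)
  pose eta := gap / 2 / (rho - t1).
  have eta0 : 0 < eta by rewrite !divr_gt0.
  have [eps /andP[e0 e1] Heps] :=
    slope_perturbation gamma0 g_C2 g2_gt0 g1_0 g1_lim m0 r_gt0 rt1 eta0.
  have e01 : 0 <= eps < 1 by rewrite ltW.
  have [r1 [rr1 r1t1 Hr1]] : exists r1, [/\ r < r1, r1 < t1 & M < slope g r n.-1 eps r1].
    have C : psi r n.-1 0 t @[t --> (r : R)] --> psi r n.-1 0 r by exact: psi_continuous.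
    have pr : psi r n.-1 0 r = 1 by rewrite psi0E mulfV// expf_neq0// gt_eqF.
    have d1M : d1 g M < psi r n.-1 0 r by rewrite pr; exact: (d1_lt1 g_C2).
    have N : \forall s \near r^'+, d1 g M < psi r n.-1 0 s.
      exact: (cvgr_gt _ (cvg_at_right_filter C)).
    near r^'+ => r1; exists r1.
    have rr1 : r < r1 by near: r1; exact: nbhs_right_gt.
    have r1t1 : r1 < t1 by near: r1; exact: nbhs_right_lt.
    split=> //.
    apply: (slope_gt g_C2) => //.
    have /andP[+ _] := psi_ge_psi0 m0 r_gt0 rr1 (ltW e0); apply: lt_le_trans.
    by near: r1.
  (* The primitive starts before r1, so that it is differentiable at r1. *)
  pose r2 := (r + r1) / 2.
  have rr2 : r < r2 by rewrite /r2; lra.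
  have r2r1 : r2 < r1 by rewrite /r2; lra.
  have [P PD] := slope_primitive g_C2 g2_gt0 g1_0 g1_lim (rho + 1) m0 r_gt0 rr2 e01.
  have rho1 : rho < rho + 1 by rewrite ltrDl.
  pose K := [set x : 'rV[R]_n | r1 <= enorm x <= rho].
  have KD : K `<=` closure D by rewrite clD => x /andP[x1' x2]; rewrite /= x2 andbT; lra.
  have cptK : compact K.
    apply: (@bounded_closed_rV_compact _ _ rho); first exact: closed_shell_closed.
    by move=> x /andP[].
  pose h x := u x + P (enorm x).
  have hc : {within K, continuous h}.
    apply/subspace_continuousP => x Kx; apply: cvgD.
      have /subspace_continuousP := continuous_subspaceW KD uc; exact.
    apply: cvg_within_filter.
    apply: (@continuous_comp _ _ _ (@enorm R n) P x); first exact: enorm_continuous.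
    have /andP[x1' x2] := Kx.
    by apply: (is_derive_continuous (PD _ _)); lra.
  have K1 : K x1 by rewrite /K/= !ltW.
  have [x0 Kx0 Hmax] := EVT_max_rV (ex_intro _ _ K1) cptK hc.
  rewrite inE in Kx0; have /andP[x0r1 x0rho] := Kx0.
  have hx1 : h x1 <= h x0 by apply: Hmax; rewrite inE.
  have [x0E|x0ne] := eqVneq (enorm x0) rho.
    have := outer _ x0E.
    (* The maximum is on the outer sphere: compare the two barriers at t1. *)
    pose W := (P - kint g r n.-1).
    have WD t : t1 <= t -> t <= rho -> is_derive t 1 W (slope g r n.-1 eps t - slope g r n.-1 0 t).
      move=> tt1 trho; apply: is_deriveB; first by apply: PD; lra.
      by apply: (is_derive_kint gamma0 g_C2) => //; lra.
    have WC : {within `[t1, rho], continuous W}.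
      apply: continuous_within_segment => t /andP[tt1 trho].
      exact: is_derive_continuous (WD t tt1 trho).
    have WD' t : t \in `]t1, rho[ ->
        is_derive t 1 W (slope g r n.-1 eps t - slope g r n.-1 0 t).
      by rewrite in_itv/= => /andP[tt1 trho]; apply: WD; exact: ltW.
    have [c] := MVT t1rho WD' WC.
    rewrite in_itv/= => /andP[ct1 crho] E.
    have := Heps c (ltW ct1); rewrite -lerBlDl => Hc.
    have : W rho - W t1 <= eta * (rho - t1) by rewrite E ler_wpM2r// ltW.
    rewrite /eta mulfVK ?gt_eqF//.
    move: hx1; rewrite /h x0E /W /= -/t1 => hx1 W1 u1.
    have : gap = u x1 - (- kint g r n.-1 t1 + a) by [].
    have : (P - kint g r n.-1) rho - (P - kint g r n.-1) t1 =
      P rho - kint g r n.-1 rho - (P t1 - kint g r n.-1 t1) by [].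
    lra.
  have x0lt : enorm x0 < rho by rewrite lt_neqAle x0ne.
  have x0r : r < enorm x0 by lra.
  have Dx0 : D x0 by rewrite DE /shell/= x0r.
  have x00 : 0 < enorm x0 by lra.
  have [x0E|x0ne'] := eqVneq (enorm x0) r1.
    (* The maximum is on the inner sphere, but u + P(|.|) increases outwards. *)
    pose nu := (enorm x0)^-1 *: x0.
    have nuN : enorm nu = 1.
      by rewrite enormZ gtr0_norm ?invr_gt0// mulVf// gt_eqF.
    have nu1 i : `|nu 0 i| <= 1 by rewrite -nuN; exact: coord_le_enorm.
    have xs s : x0 + s *: nu = (1 + s / enorm x0) *: x0.
      by rewrite /nu scalerA scalerDl scale1r.
    have es s : 0 <= s -> enorm (x0 + s *: nu) = r1 + s.
      move=> s0; rewrite xs enormZ ger0_norm ?addr_ge0// ?divr_ge0// ?(ltW x00)//.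
      by rewrite mulrDl mul1r mulfVK ?gt_eqF// x0E.
    have N0 : enorm (x0 + 0 *: nu) = r1 by rewrite es// addr0.
    have FD : is_derive (0 : R) 1 (fun s => h (x0 + s *: nu))
      (\sum_i nu 0 i * partial i u x0 + slope g r n.-1 eps r1 * (dot (x0 + 0 *: nu) nu / enorm (x0 + 0 *: nu))).
      have D1 : is_derive (0 : R) 1 (fun s => u (x0 + s *: nu)) (\sum_i nu 0 i * partial i u x0).
        by apply: is_derive_line; rewrite scale0r addr0; exact: C1_on_is_derive oD u_C2.1 Dx0.
      have Np : 0 < enorm (x0 + 0 *: nu) by rewrite N0; lra.
      have PD' : is_derive (enorm (x0 + 0 *: nu)) 1 P (slope g r n.-1 eps r1).
        by rewrite N0; apply: PD; lra.
      have D2 := @is_derive1_comp R P (fun s => enorm (x0 + s *: nu)) 0 _ _ PD' (is_derive_enorm_line Np).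
      exact: is_deriveD D1 D2.
    have dn : dot x0 nu = enorm x0.
      by rewrite dotZr -enorm_sq expr2 mulKf// gt_eqF.
    rewrite N0 scale0r addr0 dn x0E mulfV ?mulr1 in FD; last by rewrite gt_eqF//; lra.
    have FD0 : 0 < \sum_i nu 0 i * partial i u x0 + slope g r n.-1 eps r1.
      have := HM x0 nu Dx0 nu1; rewrite ler_norml => /andP[H _]; lra.
    have [e ep He] := derive_gt0_right FD FD0.
    pose s := Num.min e (rho - r1) / 2.
    have mp : 0 < Num.min e (rho - r1) by rewrite lt_min ep subr_gt0/=; lra.
    have me : Num.min e (rho - r1) <= e by rewrite ge_min lexx.
    have mr : Num.min e (rho - r1) <= rho - r1 by rewrite ge_min lexx orbT.
    have s0 : 0 < s by rewrite /s; lra.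
    have := He s; rewrite s0 /= scale0r addr0 => /(_ _).
    have -> : s < e by rewrite /s; lra.
    move=> /(_ isT); apply/negP; rewrite -leNgt; apply: Hmax.
    by rewrite inE /K/= es ?(ltW s0)// lerDl (ltW s0)/= /s; lra.
  have x0r1' : r1 < enorm x0 by rewrite lt_neqAle eq_sym x0ne'.
  have x0rr : 0 < r < enorm x0 by rewrite r_gt0.
  have e01' : 0 < eps < 1 by rewrite e0.
  have NP : \forall s \near enorm x0, is_derive (s : R) 1 P (slope g r n.-1 eps s).
    near=> s; apply: PD; apply/andP; split.
      by near: s; apply: lt_nbhsr; lra.
    by near: s; apply: lt_nbhsl; lra.
  apply: (no_interior_touching n_ge2 g_C2 g2_gt0 g1_0 g1_lim oD u_C2 Dx0 (u_sol _ Dx0) x0rr e01' NP).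
  have : nbhs x0 (shell r1 rho).
    by apply: open_nbhs_nbhs; split; [exact: shell_open|rewrite /shell/= x0r1'].
  apply: filterS => y /andP[yr1 yrho]; apply: Hmax.
  by rewrite inE /K/= !ltW.
move=> x; rewrite -/D clD kE => /andP[]; rewrite le_eqVlt => /orP[/eqP rx _|rx].
  have -> : kint g r n.-1 (enorm x) = 0.
    by rewrite -rx /kint set_itvoo0 Rintegral_set0.
  rewrite oppr0 add0r leNgt; apply/negP => ua.
  have clx : closure D x by rewrite clD /= -rx lexx ltW.
  have : within (closure D) (nbhs x) (fun y => a < u y).
    have /subspace_continuousP/(_ _ clx) C := uc.
    exact: (cvgr_gt _ C).
  rewrite /within/= => N.
  have [y [Dy /(_ (subset_closure Dy))]] := clx _ N.
  rewrite DE in Dy.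
  have := inner _ Dy; have := kint_ge0 g_C2 g2_gt0 g1_0 g1_lim (enorm y) m0 r_gt0.
  lra.
rewrite le_eqVlt => /orP[/eqP xr|xr]; first by rewrite xr; exact: outer.
by apply: inner; rewrite rx.
Unshelve. all: by end_near. Qed.
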